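(* Let $Y>0$ be fixed and put $P(Y):=\sum_{p\le Y}\#\mathfrak{A}_p/p^4$. There is an absolute constant $c>0$ such that for every $\beta>0$: (i) the proportion (lower density, with elliptic curves ordered by height) of elliptic curves $E/\mathbb{Q}$ satisfying $\big|\#\Pi_{lt,E}(Y)-P(Y)\big|<\beta\sqrt{P(Y)}$ is at least $1-c/\beta^2$; (ii) for all $C,D>Y^4$, letting $\mathcal{S}_{C,D}$ be the set of pairs $(a,b)\in\mathbb{Z}^2$ with $|a|<C$, $|b|<D$, and $\mathcal{Q}^\beta_{C,D}$ the set of $(a,b)\in\mathcal{S}_{C,D}$ with $\big|\#\Pi_{lt,E_{a,b}}(Y)-P(Y)\big|\ge\beta\sqrt{P(Y)}$, one has $\#\mathcal{Q}^\beta_{C,D}/\#\mathcal{S}_{C,D}<c/\beta^2$.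
   Context: For $(A,B)\in(\mathbb{Z}/p^2\mathbb{Z})^2$, $E_{A,B}$ is $y^2=x^3+Ax+B$ with discriminant $\Delta_{A,B}=-16(4A^3+27B^2)$; $\mathfrak{A}_p$ is the set of $(A,B)\in(\mathbb{Z}/p^2\mathbb{Z})^2$ with $p\nmid\Delta_{A,B}$ and $\dim_{\mathbb{F}_p}\big(E_{A,B}(\mathbb{Z}/p^2\mathbb{Z})\otimes\mathbb{F}_p\big)=2$. For an elliptic curve $E/\mathbb{Q}$, $\Pi_{lt,E}$ is the set of primes $p$ at which $E$ has good reduction and $E(\mathbb{Q}_p)[p]\neq0$, and $\Pi_{lt,E}(Y)=\{p\in\Pi_{lt,E}:p\le Y\}$; for $(a,b)\in\mathbb{Z}^2$, $E_{a,b}$ is the curve $y^2=x^3+ax+b$, and the paper identifies $\#\Pi_{lt,E_{a,b}}(Y)$ with $\#\{p\le Y: (a\bmod p^2,b\bmod p^2)\in\mathfrak{A}_p\}$. Elliptic curves over $\mathbb{Q}$ are ordered by height $H(E)=\max\{|a|^3,b^2\}$ of the minimal model $y^2=x^3+ax+b$ (no prime $\ell$ with $\ell^4\mid a$, $\ell^6\mid b$).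
   Formalization: P(Y)>0 is assumed, since both claims fail when P(Y)=0 (e.g. Y=1) for large β; #Π_{lt,E}(Y) is taken, by the paper's identification, as the number of primes p≤Y with (a,b) mod p² in 𝔄_p. *)

(* Defs.v *)
From HB Require Import structures.
From mathcomp Require Import all_boot all_order all_algebra.
From mathcomp Require Import boolp reals.

Set Implicit Arguments.
Unset Strict Implicit.
Unset Printing Implicit Defensive.

Import Order.TTheory GRing.Theory Num.Theory.
Local Open Scope ring_scope.

(* Group law on E_{a,b}(R) for y^2 z = x^3 + a x z^2 + b z^3 over a         *)
(* commutative ring R.  law1, law2, law3 form a basis of the (2,2) addition  *)
(* laws of Bosma--Lenstra for this Weierstrass model (derived and checked     *)
(* numerically: they agree with the chord-tangent law, and over Z/p^2Z the    *)
(* resulting operation is a commutative associative group law with identity   *)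
(* (0:1:0)).  Over a local ring (such as Z/p^2Z) P+Q is represented by any of *)
(* these laws whose output is unimodular, and at least one of them is.        *)
Section Weierstrass.
Variable R : comUnitRingType.

Definition law1 (a b : R) (P Q : R * R * R) : R * R * R :=
  let: (X1, Y1, Z1) := P in let: (X2, Y2, Z2) := Q in
  (- X1 * X1 * Z2 * Z2 * a + 2 * X1 * Y1 * Y2 * Z2 + X1 * Z1 * Y2 * Y2 - 3 * X1 * Z1 * Z2 * Z2 * b - Y1 * Y1 * X2 * Z2 - 2 * Y1 * Z1 * X2 * Y2 + Z1 * Z1 * X2 * X2 * a + 3 * Z1 * Z1 * X2 * Z2 * b,
   - 3 * X1 * X1 * X2 * Y2 + 3 * X1 * Y1 * X2 * X2 + X1 * Y1 * Z2 * Z2 * a - 2 * X1 * Z1 * Y2 * Z2 * a - Y1 * Y1 * Y2 * Z2 + 2 * Y1 * Z1 * X2 * Z2 * a + Y1 * Z1 * Y2 * Y2 + 3 * Y1 * Z1 * Z2 * Z2 * b - Z1 * Z1 * X2 * Y2 * a - 3 * Z1 * Z1 * Y2 * Z2 * b,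
   3 * X1 * X1 * X2 * Z2 - 3 * X1 * Z1 * X2 * X2 + X1 * Z1 * Z2 * Z2 * a - Y1 * Y1 * Z2 * Z2 - Z1 * Z1 * X2 * Z2 * a + Z1 * Z1 * Y2 * Y2).

Definition law2 (a b : R) (P Q : R * R * R) : R * R * R :=
  let: (X1, Y1, Z1) := P in let: (X2, Y2, Z2) := Q in
  (X1 * X1 * X2 * Z2 * a + X1 * X1 * Y2 * Y2 + 3 * X1 * X1 * Z2 * Z2 * b - X1 * Z1 * X2 * X2 * a - X1 * Z1 * Z2 * Z2 * a * a - Y1 * Y1 * X2 * X2 - 3 * Z1 * Z1 * X2 * X2 * b + Z1 * Z1 * X2 * Z2 * a * a,
   X1 * X1 * Y2 * Z2 * a - 2 * X1 * Y1 * X2 * Z2 * a + X1 * Y1 * Y2 * Y2 - 3 * X1 * Y1 * Z2 * Z2 * b + 2 * X1 * Z1 * X2 * Y2 * a + 6 * X1 * Z1 * Y2 * Z2 * b - Y1 * Y1 * X2 * Y2 - Y1 * Z1 * X2 * X2 * a - 6 * Y1 * Z1 * X2 * Z2 * b + Y1 * Z1 * Z2 * Z2 * a * a + 3 * Z1 * Z1 * X2 * Y2 * b - Z1 * Z1 * Y2 * Z2 * a * a,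
   - X1 * X1 * Z2 * Z2 * a - 2 * X1 * Y1 * Y2 * Z2 + X1 * Z1 * Y2 * Y2 - 3 * X1 * Z1 * Z2 * Z2 * b - Y1 * Y1 * X2 * Z2 + 2 * Y1 * Z1 * X2 * Y2 + Z1 * Z1 * X2 * X2 * a + 3 * Z1 * Z1 * X2 * Z2 * b).

Definition law3 (a b : R) (P Q : R * R * R) : R * R * R :=
  let: (X1, Y1, Z1) := P in let: (X2, Y2, Z2) := Q in
  (- X1 * X1 * Y2 * Z2 * a - 2 * X1 * Y1 * X2 * Z2 * a + X1 * Y1 * Y2 * Y2 - 3 * X1 * Y1 * Z2 * Z2 * b - 2 * X1 * Z1 * X2 * Y2 * a - 6 * X1 * Z1 * Y2 * Z2 * b + Y1 * Y1 * X2 * Y2 - Y1 * Z1 * X2 * X2 * a - 6 * Y1 * Z1 * X2 * Z2 * b + Y1 * Z1 * Z2 * Z2 * a * a - 3 * Z1 * Z1 * X2 * Y2 * b + Z1 * Z1 * Y2 * Z2 * a * a,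
   3 * X1 * X1 * X2 * X2 * a + 9 * X1 * X1 * X2 * Z2 * b - X1 * X1 * Z2 * Z2 * a * a + 9 * X1 * Z1 * X2 * X2 * b - 4 * X1 * Z1 * X2 * Z2 * a * a - 3 * X1 * Z1 * Z2 * Z2 * a * b + Y1 * Y1 * Y2 * Y2 - Z1 * Z1 * X2 * X2 * a * a - 3 * Z1 * Z1 * X2 * Z2 * a * b - 9 * Z1 * Z1 * Z2 * Z2 * b * b - Z1 * Z1 * Z2 * Z2 * a ^+ 3,
   3 * X1 * X1 * X2 * Y2 + 3 * X1 * Y1 * X2 * X2 + X1 * Y1 * Z2 * Z2 * a + 2 * X1 * Z1 * Y2 * Z2 * a + Y1 * Y1 * Y2 * Z2 + 2 * Y1 * Z1 * X2 * Z2 * a + Y1 * Z1 * Y2 * Y2 + 3 * Y1 * Z1 * Z2 * Z2 * b + Z1 * Z1 * X2 * Y2 * a + 3 * Z1 * Z1 * Y2 * Z2 * b).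

Definition unimod (v : R * R * R) : bool :=
  let: (x, y, z) := v in [|| x \is a GRing.unit, y \is a GRing.unit | z \is a GRing.unit].

Definition on_curve (a b : R) (v : R * R * R) : bool :=
  let: (x, y, z) := v in
  unimod v && (y ^+ 2 * z == x ^+ 3 + a * x * z ^+ 2 + b * z ^+ 3).

Definition scale3 (u : R) (v : R * R * R) : R * R * R :=
  let: (x, y, z) := v in (u * x, u * y, u * z).

Definition pt_O : R * R * R := (0, 1, 0).

Definition addT (a b : R) (P Q : R * R * R) : R * R * R :=
  let l1 := law1 a b P Q in
  let l2 := law2 a b P Q in
  if unimod l1 then l1 else if unimod l2 then l2 else law3 a b P Q.

Definition mulT (a b : R) (n : nat) (P : R * R * R) : R * R * R :=
  iter n (addT a b P) pt_O.

End Weierstrass.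

Section FrakA.
Variable p : nat.
Local Notation Zp2 := 'Z_(p ^ 2).

Definition proj_class (v : Zp2 * Zp2 * Zp2) : {set Zp2 * Zp2 * Zp2} :=
  [set w | [exists u : Zp2, (u \is a GRing.unit) && (w == scale3 u v)]].

Definition E_pts (A B : Zp2) : {set {set Zp2 * Zp2 * Zp2}} :=
  [set proj_class v | v in [pred v | on_curve A B v]].

Definition pE_pts (A B : Zp2) : {set {set Zp2 * Zp2 * Zp2}} :=
  [set proj_class (mulT A B p v) | v in [pred v | on_curve A B v]].

(* dim_{F_p} (E(Z/p^2Z) (x) F_p) = log_p #(E / pE), and #(E/pE) = #E / #pE *)
Definition dim_tensor_Fp (A B : Zp2) : nat :=
  logn p (#|E_pts A B| %/ #|pE_pts A B|).

Definition disc (A B : Zp2) : Zp2 := - 16 * (4 * A ^+ 3 + 27 * B ^+ 2).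

Definition frakA : {set Zp2 * Zp2} :=
  [set AB | ~~ (p %| nat_of_ord (disc AB.1 AB.2))%N && (dim_tensor_Fp AB.1 AB.2 == 2%N)].

End FrakA.

Section Counting.
Variable R : realType.

Definition Pi_lt_count (a b : int) (Y : R) : nat :=
  #|[set p : 'I_(Num.truncn Y).+1 |
      [&& prime p, (p%:R <= Y)
        & ((a%:~R, b%:~R) : 'Z_(p ^ 2) * 'Z_(p ^ 2)) \in frakA p]]|.

Definition PY (Y : R) : R :=
  \sum_(p < (Num.truncn Y).+1 | prime p && (p%:R <= Y)) (#|frakA p|%:R / p%:R ^+ 4).

Definition int_range (K : nat) : seq int := [seq (i%:Z - K%:Z) | i <- iota 0 (K.*2.+1)].

Definition box (C D : R) : seq (int * int) :=
  let K := (Num.truncn C + Num.truncn D).+1 in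
  [seq ab <- [seq (a, b) | a <- int_range K, b <- int_range K]
     | (`|ab.1|%:~R < C) && (`|ab.2|%:~R < D)].

Definition box_bad (Y beta C D : R) : seq (int * int) :=
  [seq ab <- box C D
     | Num.sqrt (PY Y) * beta <= `|(Pi_lt_count ab.1 ab.2 Y)%:R - PY Y| ].

(* Elliptic curves over Q <-> minimal short Weierstrass models (a,b) *)
Definition is_min_model (a b : int) : bool :=
  (4 * a ^+ 3 + 27 * b ^+ 2 != 0) &&
  `[< forall l : nat, prime l -> ~ ((l%:Z ^+ 4 %| a)%Z /\ (l%:Z ^+ 6 %| b)%Z) >].

Definition height (a b : int) : int := Num.max (`|a| ^+ 3) (b ^+ 2).

Definition curves_upto (X : R) : seq (int * int) :=
  let K := (Num.truncn X).+1 in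
  [seq ab <- [seq (a, b) | a <- int_range K, b <- int_range K]
     | is_min_model ab.1 ab.2 && ((height ab.1 ab.2)%:~R <= X)].

Definition curves_good_upto (Y beta X : R) : seq (int * int) :=
  [seq ab <- curves_upto X
     | `|(Pi_lt_count ab.1 ab.2 Y)%:R - PY Y| < beta * Num.sqrt (PY Y)].

End Counting.

(* Main.v *)
Require Import Defs.
From HB Require Import structures.
From mathcomp Require Import all_boot all_order all_algebra all_field.
From mathcomp Require Import boolp reals.
From mathcomp Require Import ring lra zify.
Import Order.TTheory GRing.Theory Num.Theory.
Local Open Scope ring_scope.

(** Everything rests on the bound #|frakA p| <= 11 p^3, that is, on the density of frakA p being
    O(1/p).  Let p > 10 and (A, B) in frakA p.  Since the cubic takes a nonsquare value on F_p
    (Stepanov), E(Z/p^2) has fewer than 2 p^2 points, so dimension 2 forces p P = O for every P.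
    If p P = O with P = (x0, y0), the function with divisor p(P) - p(O) (Miller's construction)
    is a + y b with a^2 - f b^2 = -(x - x0)^p over Z/p^2.  Modulo p such a pair (a, b) is unique
    up to sign.  If B moves to B + p tau while A, x0 and B mod p stay fixed, this norm equation
    linearizes to 2 (a al - f b be) = tau b^2 over F_p, and an elementary divisibility argument
    gives tau = 0 as soon as A is nonzero mod p.  Hence, outside the p^3 pairs with p | A,
    (A, B) in frakA p is determined by A and B mod p.

    With this bound, the Chinese remainder theorem on a box of sides at least Y^4 gives a second
    moment O(PY) for the deviation of the count from PY: the error terms add up to
    (sum_p density(p) p^2)^2 / Y^4 <= PY * (sum_p #|frakA p|) / Y^4 = O(PY).  Part (ii) is
    Chebyshev's inequality, and part (i) follows from it because a positive proportion of the pairs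
    in the box |a|^3, b^2 <= X are minimal models. *)

(** * Addition laws *)

(** No group axiom for [addT] is proved: torsion is seen only through translation by P acting on
    projective classes, and the dimension only through the cardinals of E and pE. The norm equation
    is an elementary substitute for canonical lifts: for large p, a curve counted in [frakA] is the
    canonical lift modulo p^2 of its reduction, and the rigidity argument recovers as much of that
    uniqueness as the count requires. The case p | A is a true exception to rigidity: the
    isomorphisms (A, B) -> (u^4 A, u^6 B) with u = 1 mod p then fix A and move B through its whole
    class mod p. The abscissa x0 can stay fixed while B moves because y0, being a unit, absorbs the
    change. A density O(1/p) is what the second moment needs: a pair p, q costs density(p)
    density(q) p^2 q^2 / Y^4, and the trivial bound on the densities would only control the total up
    to an extra factor Y. *)

Lemma eq_from_sub (V : zmodType) (x y z : V) : x - y = z -> z = 0 -> x = y.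
Proof. by move=> <- /subr0_eq. Qed.

Section Laws.
Variable R : comUnitRingType.
Implicit Types (a b u : R) (P Q v : R * R * R).

Lemma law1_chord a b x0 y0 x1 y1 l :
    y0 ^+ 2 = x0 ^+ 3 + a * x0 + b -> y1 ^+ 2 = x1 ^+ 3 + a * x1 + b ->
    l * (x1 - x0) = y1 - y0 ->
  let x2 := l ^+ 2 - x0 - x1 in
  law1 a b (x0, y0, 1) (x1, y1, 1) =
    scale3 ((x1 - x0) ^+ 3) (x2, - (y0 + l * (x2 - x0)), 1).
Proof.
move=> c0 c1 hl x2; rewrite /law1 /scale3 /x2.
have r0 : y0 ^+ 2 - (x0 ^+ 3 + a * x0 + b) = 0 by rewrite c0 subrr.
have r1 : y1 ^+ 2 - (x1 ^+ 3 + a * x1 + b) = 0 by rewrite c1 subrr.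
have r2 : l * (x1 - x0) - (y1 - y0) = 0 by rewrite hl subrr.
set q0 := y0 ^+ 2 - _ in r0; set q1 := y1 ^+ 2 - _ in r1; set q2 := l * _ - _ in r2.
congr (_, _, _).
(* Certificate of ideal membership: the difference of the two sides is an explicit combination of
   the relations [q0], [q1], [q2]; [ring] checks it and the relations make it vanish. The same
   device recurs throughout. *)
- apply: (@eq_from_sub _ _ _ ((2 * x0 - x1) * q1 + (x0 - 2 * x1) * q0
    - (x1 - x0) * (l * (x1 - x0) + (y1 - y0)) * q2)); last first.
    by rewrite r0 r1 r2 !(mulr0, subr0, addr0).
  by rewrite /q0 /q1 /q2; ring.
- apply: (@eq_from_sub _ _ _ ((2 * y1 - y0) * q0 + (y1 - 2 * y0) * q1
    + q2 * ((l * (x1 - x0)) ^+ 2 + l * (x1 - x0) * (y1 - y0) + (y1 - y0) ^+ 2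
            - (x1 - x0) ^+ 2 * (2 * x0 + x1)))); last first.
    by rewrite r0 r1 r2 !mulr0 mul0r !addr0.
  by rewrite /q0 /q1 /q2; ring.
- apply: (@eq_from_sub _ _ _ (q1 - q0)); last by rewrite r0 r1 subr0.
  by rewrite /q0 /q1; ring.
Qed.

(** Together with [law2_double]: the first two laws degenerate on the diagonal, so [addT] doubles an
    affine point by [law3]. *)
Lemma law1_double a b x y : law1 a b (x, y, 1) (x, y, 1) = (0, 0, 0).
Proof. by rewrite /law1; congr (_, _, _); ring. Qed.

Lemma law2_double a b x y : law2 a b (x, y, 1) (x, y, 1) = (0, 0, 0).
Proof. by rewrite /law2; congr (_, _, _); ring. Qed.

Lemma law3_double a b x y l :
    y ^+ 2 = x ^+ 3 + a * x + b -> l * (2 * y) = 3 * x ^+ 2 + a ->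
  let x2 := l ^+ 2 - x - x in
  law3 a b (x, y, 1) (x, y, 1) =
    scale3 (8 * y ^+ 3) (x2, - (y + l * (x2 - x)), 1).
Proof.
move=> c0 hl x2; rewrite /law3 /scale3 /x2.
have r0 : y ^+ 2 - (x ^+ 3 + a * x + b) = 0 by rewrite c0 subrr.
have r2 : l * (2 * y) - (3 * x ^+ 2 + a) = 0 by rewrite hl subrr.
set q0 := y ^+ 2 - _ in r0; set q2 := l * _ - _ in r2.
set g := x ^+ 3 + a * x + b; set m := 3 * x ^+ 2 + a.
congr (_, _, _).
- apply: (@eq_from_sub _ _ _ (18 * x * y * q0 - 2 * y * (l * (2 * y) + m) * q2)).
    by rewrite /q0 /q2 /m; ring.
  by rewrite r0 r2 !(mulr0, subr0).
- apply: (@eq_from_sub _ _ _ (q0 * (9 * y ^+ 2 + 9 * g - 12 * m * x)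
     + q2 * ((l * (2 * y)) ^+ 2 + l * (2 * y) * m + m ^+ 2 - 12 * x * y ^+ 2))).
    by rewrite /q0 /q2 /m /g; ring.
  by rewrite r0 r2 !mul0r addr0.
- apply: (@eq_from_sub _ _ _ (- 6 * y * q0)); last by rewrite r0 mulr0.
  by rewrite /q0; ring.
Qed.

(** Serves to upgrade x1 = x0 modulo p to an equality: when the sum is O this product is zero, and
    its second factor is a unit as soon as the two points reduce to opposite points with 2y
    nonzero. *)
Lemma law1_vertical a b x0 y0 x1 y1 :
    y0 ^+ 2 = x0 ^+ 3 + a * x0 + b -> y1 ^+ 2 = x1 ^+ 3 + a * x1 + b ->
  (law1 a b (x0, y0, 1) (x1, y1, 1)).1.1 =
    (x1 - x0) * ((y1 - y0) ^+ 2 - (x0 + x1) * (x1 - x0) ^+ 2).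
Proof.
move=> c0 c1.
have r0 : y0 ^+ 2 - (x0 ^+ 3 + a * x0 + b) = 0 by rewrite c0 subrr.
have r1 : y1 ^+ 2 - (x1 ^+ 3 + a * x1 + b) = 0 by rewrite c1 subrr.
set q0 := y0 ^+ 2 - _ in r0; set q1 := y1 ^+ 2 - _ in r1.
apply: (@eq_from_sub _ _ _ ((2 * x0 - x1) * q1 + (x0 - 2 * x1) * q0)).
  by rewrite /q0 /q1 /=; ring.
by rewrite r0 r1 !mulr0 addr0.
Qed.

Lemma law1_opp a b x y : y ^+ 2 = x ^+ 3 + a * x + b ->
  law1 a b (x, y, 1) (x, - y, 1) = (0, 8 * y ^+ 3, 0).
Proof.
move=> c0; have r0 : y ^+ 2 - (x ^+ 3 + a * x + b) = 0 by rewrite c0 subrr.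
set q0 := y ^+ 2 - _ in r0.
rewrite /law1; congr (_, _, _); try by ring.
apply: (@eq_from_sub _ _ _ (- 6 * y * q0)); last by rewrite r0 mulr0.
by rewrite /q0; ring.
Qed.

Lemma law1_O a b x y : law1 a b (x, y, 1) (pt_O R) = (x, y, 1).
Proof. by rewrite /law1 /pt_O; congr (_, _, _); ring. Qed.

Lemma addT_OO a b : addT a b (pt_O R) (pt_O R) = pt_O R.
Proof.
have e1 : law1 a b (pt_O R) (pt_O R) = (0, 0, 0).
  by rewrite /law1 /pt_O; congr (_, _, _); ring.
have e2 : law2 a b (pt_O R) (pt_O R) = (0, 0, 0).
  by rewrite /law2 /pt_O; congr (_, _, _); ring.
rewrite /addT e1 e2 /unimod unitr0 /=.
by rewrite /law3 /pt_O; congr (_, _, _); ring.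
Qed.

Lemma mulT_O a b n : mulT a b n (pt_O R) = pt_O R.
Proof. by rewrite /mulT; elim: n => //= n ->; rewrite addT_OO. Qed.

Lemma unimod_scale3 u v : u \is a GRing.unit -> unimod (scale3 u v) = unimod v.
Proof. by case: v => [[x y] z] hu; rewrite /unimod /scale3 !unitrMr. Qed.

Lemma scale3A u w v : scale3 u (scale3 w v) = scale3 (u * w) v.
Proof. by case: v => [[x y] z]; rewrite /scale3 !mulrA. Qed.

Lemma scale3_1 v : scale3 1 v = v.
Proof. by case: v => [[x y] z]; rewrite /scale3 !mul1r. Qed.

(** The laws have degree 2 in the second point, and scaling by a unit does not change which outputs
    are unimodular, so the same branch is taken. *)
Lemma addT_scaler a b u P Q : u \is a GRing.unit ->
  addT a b P (scale3 u Q) = scale3 (u ^+ 2) (addT a b P Q).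
Proof.
move=> hu; have hu2 : u ^+ 2 \is a GRing.unit by rewrite unitrX.
have e1 : law1 a b P (scale3 u Q) = scale3 (u ^+ 2) (law1 a b P Q).
  by case: P Q => [[? ?] ?] [[? ?] ?]; rewrite /law1 /scale3; congr (_, _, _); ring.
have e2 : law2 a b P (scale3 u Q) = scale3 (u ^+ 2) (law2 a b P Q).
  by clear e1; case: P Q => [[? ?] ?] [[? ?] ?]; rewrite /law2 /scale3; congr (_, _, _); ring.
have e3 : law3 a b P (scale3 u Q) = scale3 (u ^+ 2) (law3 a b P Q).
  by clear e1 e2; case: P Q => [[? ?] ?] [[? ?] ?]; rewrite /law3 /scale3; congr (_, _, _); ring.
by rewrite /addT e1 e2 e3 !unimod_scale3 //; do 2?case: ifP.
Qed.

Lemma mulTS a b n P : mulT a b n.+1 P = addT a b P (mulT a b n P).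
Proof. by []. Qed.

Definition proportional v w := exists2 u : R, u \is a GRing.unit & w = scale3 u v.

Lemma proportional_refl v : proportional v v.
Proof. by exists 1; rewrite ?unitr1 ?scale3_1. Qed.

Lemma proportional_sym v w : proportional v w -> proportional w v.
Proof.
case=> u hu ->; exists u^-1; rewrite ?unitrV // scale3A mulVr //.
by rewrite scale3_1.
Qed.

Lemma proportional_trans w v t :
  proportional v w -> proportional w t -> proportional v t.
Proof.
by case=> u hu -> [u' hu' ->]; exists (u' * u); rewrite ?unitrMl ?scale3A.
Qed.

Lemma proportional_addT a b P v w :
  proportional v w -> proportional (addT a b P v) (addT a b P w).
Proof. by case=> u hu ->; rewrite addT_scaler //; exists (u ^+ 2); rewrite ?unitrX. Qed.

Lemma proportional_mulT a b P m n k :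
    proportional (mulT a b m P) (mulT a b n P) ->
  proportional (mulT a b (k + m) P) (mulT a b (k + n) P).
Proof. by move=> h; elim: k => // k; rewrite !addSn !mulTS; apply: proportional_addT. Qed.

End Laws.

(** * Compatibility of the addition with reduction *)

Section Morphism.
Variables (R S : comUnitRingType) (pi : {rmorphism R -> S}).
Hypothesis unitE : forall x, (x \is a GRing.unit) = (pi x \is a GRing.unit).

Definition map3 (v : R * R * R) : S * S * S := (pi v.1.1, pi v.1.2, pi v.2).

(** [addT] branches on unimodularity; since pi detects units, both sides select the same law. *)
Lemma map3_addT a b P Q :
  map3 (addT a b P Q) = addT (pi a) (pi b) (map3 P) (map3 Q).
Proof.
have e1 : map3 (law1 a b P Q) = law1 (pi a) (pi b) (map3 P) (map3 Q).
  by case: P Q => [[? ?] ?] [[? ?] ?]; rewrite /law1 /map3 /=; congr (_, _, _); ring.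
have e2 : map3 (law2 a b P Q) = law2 (pi a) (pi b) (map3 P) (map3 Q).
  by clear e1; case: P Q => [[? ?] ?] [[? ?] ?]; rewrite /law2 /map3 /=; congr (_, _, _); ring.
have e3 : map3 (law3 a b P Q) = law3 (pi a) (pi b) (map3 P) (map3 Q).
  by clear e1 e2; case: P Q => [[? ?] ?] [[? ?] ?]; rewrite /law3 /map3 /=; congr (_, _, _); ring.
have um v : unimod (map3 v) = unimod v.
  by case: v => [[x y] z]; rewrite /unimod /map3 /= -!unitE.
by rewrite /addT -e1 -e2 -e3 !um; do 2?case: ifP.
Qed.

Lemma map3_mulT a b n P : map3 (mulT a b n P) = mulT (pi a) (pi b) n (map3 P).
Proof.
elim: n => [|n ih]; first by rewrite /map3 /= rmorph0 rmorph1.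
by rewrite !mulTS map3_addT ih.
Qed.

End Morphism.

(* The orbit of O under translation by P returns to O after p steps, and p is prime, so it has exact
   period p: no associativity is needed. *)
Lemma multiples_distinct (F : fieldType) (a b x y : F) (p i j : nat) :
    prime p -> proportional _ (pt_O F) (mulT a b p (x, y, 1)) ->
    (i < j)%N -> (j < i + p)%N ->
  ~ proportional _ (mulT a b i (x, y, 1)) (mulT a b j (x, y, 1)).
Proof.
move=> pp hp lij ljp hij; set P := (x, y, 1) in hp hij.
pose v n := mulT a b n P.
have shift m n k : proportional _ (v m) (v n) -> proportional _ (v (k + m)%N) (v (k + n)%N).
  exact: proportional_mulT.
have p_gt0 := prime_gt0 pp.
have vp k : proportional _ (v 0%N) (v (k * p)%N).
  elim: k => [|k ih]; first exact: proportional_refl.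
  rewrite mulSn addnC; apply: proportional_trans ih _.
  by rewrite -[X in proportional _ (v X)]addn0; apply: shift.
(* Translating by i * p - i moves the index i to a multiple of p, so j - i is a return time of O. *)
have vd1 : proportional _ (v 0%N) (v (j - i)%N).
  have le_i : (i <= i * p)%N by rewrite leq_pmulr.
  have h := shift _ _ (i * p - i)%N hij.
  rewrite subnK // in h.
  have -> : (j - i = (j - i) + 0)%N by rewrite addn0.
  apply: proportional_trans (vp i) _; apply: proportional_trans h _.
  have -> : (i * p - i + j = (j - i) + i * p)%N by lia.
  by apply: proportional_sym; apply: shift; apply: vp.
have vd k : proportional _ (v 0%N) (v (k * (j - i))%N).
  elim: k => [|k ih]; first exact: proportional_refl.
  rewrite mulSn addnC; apply: proportional_trans ih _.
  by rewrite -[X in proportional _ (v X)]addn0; apply: shift.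
have d_gt0 : (0 < j - i)%N by lia.
have cop : coprime (j - i) p.
  by rewrite coprime_sym prime_coprime //; apply/negP => /dvdn_leq; lia.
(* As j - i divides 1 + k p, both k p and 1 + k p are return times, so P itself would be
   proportional to O although its last coordinate is 1. *)
have [k _ hk] := Bezoutl p d_gt0; rewrite (eqP cop) in hk.
have /dvdnP [m hm] := hk.
have h1 : proportional _ (v (k * p)%N) (v (1 + k * p)%N).
  rewrite hm; apply: proportional_trans (vd m).
  by apply: proportional_sym; apply: vp.
have h2 : proportional _ (v 0%N) (v 1%N).
  apply: proportional_trans (vp k) _; apply: proportional_trans h1 _.
  have -> : 1%N = (1 + 0)%N by [].
  by apply: proportional_sym; apply: shift; apply: vp.
have v1 : v 1%N = P.
  rewrite /v mulTS /mulT /= /addT law1_O.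
  by rewrite /unimod unitr1 !orbT.
have [u _] := h2; rewrite v1 /v /mulT /= /P /scale3 mulr0 => -[_ _ e].
by have /eqP := @oner_neq0 F; rewrite e.
Qed.

(** * Miller's function *)

Section MillerStep.
Variable R : comUnitRingType.
Implicit Types (A B x y l : R) (a b : {poly R}).

Definition wpoly A B : {poly R} := 'X^3 + A%:P * 'X + B%:P.
Definition linep x y l : {poly R} := y%:P + l%:P * ('X - x%:P).

Lemma horner_wpoly A B x : (wpoly A B).[x] = x ^+ 3 + A * x + B.
Proof. by rewrite /wpoly !hornerE. Qed.

Lemma horner_linep x y l z : (linep x y l).[z] = y + l * (z - x).
Proof. by rewrite /linep !hornerE. Qed.

Lemma size_wpoly A B : (size (wpoly A B) <= 4)%N.
Proof.
rewrite /wpoly; apply: leq_trans (size_polyD _ _) _; rewrite geq_max.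
rewrite (leq_trans (size_polyC_leq1 _)) // andbT.
apply: leq_trans (size_polyD _ _) _; rewrite geq_max size_polyXn /=.
by apply: leq_trans (size_polyMleq _ _) _; rewrite size_polyX; case: (A == 0); rewrite size_polyC; case: (A != 0).
Qed.

Lemma size_linep x y l : (size (linep x y l) <= 2)%N.
Proof.
rewrite /linep; apply: leq_trans (size_polyD _ _) _; rewrite geq_max.
rewrite (leq_trans (size_polyC_leq1 _)) //=.
by apply: leq_trans (size_polyMleq _ _) _; rewrite size_XsubC size_polyC; case: (l != 0).
Qed.

(** The choice of x2 matches the X^2 coefficients, so the two cubics differ by k1 X + k0. This
    vanishes at x0 and x1; with zero divisors around, it is the unit x1 - x0 that forces k1 = 0. *)
Lemma wpoly_chord A B x0 y0 x1 y1 l :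
    y0 ^+ 2 = x0 ^+ 3 + A * x0 + B -> y1 ^+ 2 = x1 ^+ 3 + A * x1 + B ->
    l * (x1 - x0) = y1 - y0 -> (x1 - x0) \is a GRing.unit ->
  wpoly A B - linep x0 y0 l ^+ 2 =
    ('X - x0%:P) * ('X - x1%:P) * ('X - (l ^+ 2 - x0 - x1)%:P).
Proof.
move=> c0 c1 hl hd; set x2 := l ^+ 2 - x0 - x1.
pose k1 := A - 2 * l * (y0 - l * x0) - (x0 * x1 + x0 * x2 + x1 * x2).
pose k0 := B - (y0 - l * x0) ^+ 2 + x0 * x1 * x2.
have e0 : k1 * x0 + k0 = 0.
  apply: (@eq_from_sub _ _ _ (x0 ^+ 3 + A * x0 + B - y0 ^+ 2)); last by rewrite c0 subrr.
  by rewrite /k1 /k0 /x2; ring.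
have e1 : k1 * x1 + k0 = 0.
  apply: (@eq_from_sub _ _ _ (x1 ^+ 3 + A * x1 + B - (y0 + l * (x1 - x0)) ^+ 2)).
    by rewrite /k1 /k0 /x2; ring.
  by rewrite hl [y0 + _]addrC subrK c1 subrr.
have k1_0 : k1 = 0.
  apply: (mulIr hd); rewrite mul0r mulrBr.
  by apply: (@eq_from_sub _ _ _ (k1 * x1 + k0 - (k1 * x0 + k0))); [ring | rewrite e1 e0 subrr].
have k0_0 : k0 = 0 by move: e0; rewrite k1_0 mul0r add0r.
transitivity (('X - x0%:P) * ('X - x1%:P) * ('X - x2%:P) + k1%:P * 'X + k0%:P); last first.
  by rewrite k1_0 k0_0 mul0r !addr0.
by rewrite /wpoly /linep /k1 /k0 /x2; ring.
Qed.

Lemma wpoly_tangent A B x0 y0 l :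
    y0 ^+ 2 = x0 ^+ 3 + A * x0 + B -> l * (2 * y0) = 3 * x0 ^+ 2 + A ->
  wpoly A B - linep x0 y0 l ^+ 2 =
    ('X - x0%:P) * ('X - x0%:P) * ('X - (l ^+ 2 - x0 - x0)%:P).
Proof.
move=> c0 hl; set x2 := l ^+ 2 - x0 - x0.
pose k1 := A - 2 * l * (y0 - l * x0) - (x0 * x0 + x0 * x2 + x0 * x2).
pose k0 := B - (y0 - l * x0) ^+ 2 + x0 * x0 * x2.
have k1_0 : k1 = 0.
  apply: (@eq_from_sub _ _ _ (3 * x0 ^+ 2 + A - l * (2 * y0))); last by rewrite hl subrr.
  by rewrite /k1 /x2; ring.
have k0_0 : k0 = 0.
  apply: (@eq_from_sub _ _ _ (x0 ^+ 3 + A * x0 + B - y0 ^+ 2 - k1 * x0)).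
    by rewrite /k1 /k0 /x2; ring.
  by rewrite c0 subrr k1_0 mul0r subr0.
transitivity (('X - x0%:P) * ('X - x0%:P) * ('X - x2%:P) + k1%:P * 'X + k0%:P); last first.
  by rewrite k1_0 k0_0 mul0r !addr0.
by rewrite /wpoly /linep /k1 /k0 /x2; ring.
Qed.

Lemma XsubC_cancel x (q r : {poly R}) : ('X - x%:P) * q = ('X - x%:P) * r -> q = r.
Proof. by move=> e; apply: (monic_rreg (monicXsubC x)); rewrite /= mulrC e mulrC. Qed.

Lemma size_divXsubC x (q r : {poly R}) n :
  ('X - x%:P) * q = r -> (size r <= n.+1)%N -> (size q <= n)%N.
Proof.
move=> <-; have [->|q0] := eqVneq q 0; first by rewrite size_poly0.
by rewrite mulrC size_Mmonic ?monicXsubC // size_XsubC addnS /= addn1 ltnS.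
Qed.

(* The function a + y b vanishes at -(x1, y1); it is multiplied by the equation y - L of the chord
   and divided by X - x1, so that the result vanishes at -(x2, y2). *)
Lemma miller_step A B x0 y0 x1 y1 l x2 y2 (a b : {poly R}) :
    wpoly A B - linep x0 y0 l ^+ 2 =
      ('X - x0%:P) * ('X - x1%:P) * ('X - x2%:P) ->
    y1 = y0 + l * (x1 - x0) -> y2 = - (y0 + l * (x2 - x0)) ->
    (x2 - x1 \is a GRing.unit) || (y1 - y2 \is a GRing.unit) ->
    a.[x1] = y1 * b.[x1] ->
  exists a', exists b',
    [/\ ('X - x1%:P) * a' = wpoly A B * b - a * linep x0 y0 l,
        ('X - x1%:P) * b' = a - b * linep x0 y0 l &
        a'.[x2] = y2 * b'.[x2] ].
Proof.
move=> hL hy1 hy2 hu hab; set L := linep x0 y0 l in hL *; set f := wpoly A B in hL *.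
have L1 : L.[x1] = y1 by rewrite horner_linep hy1.
have L2 : L.[x2] = - y2 by rewrite horner_linep hy2 opprK.
have hl : l%:P * ('X - x1%:P) = L - y1%:P by rewrite /L /linep hy1; ring.
clearbody L f.
have f1 : f.[x1] = y1 ^+ 2.
  have := congr1 (horner^~ x1) hL; rewrite !hornerE L1 subrr mulr0 mul0r => /subr0_eq -> //.
have f2 : f.[x2] = y2 ^+ 2.
  have := congr1 (horner^~ x2) hL; rewrite !hornerE L2 subrr mulr0 => /subr0_eq ->.
  by rewrite sqrrN.
have /factor_theorem [a' ha'] : root (f * b - a * L) x1.
  apply/rootP; rewrite !hornerE f1 L1 hab; ring.
have /factor_theorem [b' hb'] : root (a - b * L) x1.
  apply/rootP; rewrite !hornerE L1 hab; ring.
exists a', b'; split; rewrite 1?mulrC //.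
have [hu1|hu2] := orP hu.
  apply: (mulrI hu1).
  have ea := congr1 (horner^~ x2) ha'; have eb := congr1 (horner^~ x2) hb'.
  rewrite !hornerE L2 in ea eb; rewrite f2 in ea.
  transitivity (y2 * (b'.[x2] * (x2 - x1))); last by ring.
  by rewrite [LHS]mulrC -ea -eb; ring.
(* When x2 - x1 is not a unit, evaluating the defining identities at x2 loses information. Since L -
   y1 = l (X - x1), the two combinations [key] and [key'] can be freed of the factor X - x1; at x2
   they combine to (y1 - y2) (a' - y2 b'). *)
pose s := l%:P * (L + y1%:P) + ('X - x0%:P) * ('X - x2%:P).
have key : f * b' + y1%:P * a' = a * (s - (l * y1)%:P) - l%:P * f * b.
  apply: (@XsubC_cancel x1).
  have -> : ('X - x1%:P) * (f * b' + y1%:P * a') =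
    f * (b' * ('X - x1%:P)) + y1%:P * (a' * ('X - x1%:P)) by ring.
  rewrite -ha' -hb' /s.
  have -> : ('X - x1%:P) * (a * (l%:P * (L + y1%:P) + ('X - x0%:P) * ('X - x2%:P) - (l * y1)%:P)
      - l%:P * f * b) =
    a * ((l%:P * ('X - x1%:P)) * L + ('X - x0%:P) * ('X - x1%:P) * ('X - x2%:P))
      - (l%:P * ('X - x1%:P)) * f * b by ring.
  by rewrite -hL hl; ring.
have key' : a' + y1%:P * b' = b * (s - (l * y1)%:P) - l%:P * a.
  apply: (@XsubC_cancel x1).
  have -> : ('X - x1%:P) * (a' + y1%:P * b') =
    a' * ('X - x1%:P) + y1%:P * (b' * ('X - x1%:P)) by ring.
  rewrite -ha' -hb' /s.
  have -> : ('X - x1%:P) * (b * (l%:P * (L + y1%:P) + ('X - x0%:P) * ('X - x2%:P) - (l * y1)%:P)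
      - l%:P * a) =
    b * ((l%:P * ('X - x1%:P)) * L + ('X - x0%:P) * ('X - x1%:P) * ('X - x2%:P))
      - (l%:P * ('X - x1%:P)) * a by ring.
  by rewrite -hL hl; ring.
have ek := congr1 (horner^~ x2) key; have ek' := congr1 (horner^~ x2) key'.
rewrite /s !hornerE L2 subrr mulr0 in ek ek'; rewrite f2 in ek.
apply: (mulrI hu2).
apply: (@eq_from_sub _ _ _ ((y2 ^+ 2 * b'.[x2] + y1 * a'.[x2]) - y2 * (a'.[x2] + y1 * b'.[x2]))).
  by ring.
by rewrite ek ek'; ring.
Qed.

End MillerStep.

Lemma miller_sizes (j sa sb sf sL : nat) :
    (1 < j)%N -> (2 * sa <= j + 3)%N -> (2 * sb <= j)%N -> (sf <= 4)%N -> (sL <= 2)%N ->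
  (maxn (sf + sb).-1 (sa + sL).-1 <= (j + 4)./2.+1)%N /\ (maxn sa (sb + sL).-1 <= j.+1./2.+1)%N.
Proof. by move=> *; split; lia. Qed.

Section Miller.
Variables (R : comUnitRingType) (F : fieldType) (pi : {rmorphism R -> F}).
Hypothesis unitE : forall x, (x \is a GRing.unit) = (pi x != 0).
Variables (A B x0 y0 : R) (p : nat).
Hypotheses (p_prime : prime p) (p_gt2 : (2 < p)%N) (two_neq0 : 2 != 0 :> F).
Hypothesis c0 : y0 ^+ 2 = x0 ^+ 3 + A * x0 + B.
Hypothesis y0_unit : y0 \is a GRing.unit.
Let P : R * R * R := (x0, y0, 1).
Hypothesis pP_O : proportional _ (pt_O R) (mulT A B p P).
Let f := wpoly _ A B.

Lemma unit_reduction x : (x \is a GRing.unit) = (pi x \is a GRing.unit).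
Proof. by rewrite unitE unitfE. Qed.

Lemma map3_proportional v w :
  proportional _ v w -> proportional _ (map3 R F pi v) (map3 R F pi w).
Proof.
case=> u hu ->; exists (pi u); first by rewrite -unit_reduction.
by case: v => [[x y] z]; rewrite /map3 /= !rmorphM.
Qed.

Lemma map3_O : map3 R F pi (pt_O R) = pt_O F.
Proof. by rewrite /map3 /= rmorph0 rmorph1. Qed.

Lemma map3_distinct i j : (i < j)%N -> (j < i + p)%N ->
  ~ proportional _ (map3 R F pi (mulT A B i P)) (map3 R F pi (mulT A B j P)).
Proof.
move=> lij ljp; rewrite !(map3_mulT _ _ _ unit_reduction) /P /map3 /= rmorph1.
apply: (@multiples_distinct F _ _ _ _ p) => //.
have := map3_proportional _ _ pP_O.
by rewrite map3_O (map3_mulT _ _ _ unit_reduction) /P /map3 /= rmorph1.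
Qed.

Lemma affine_distinct i j u w x y x' y' : (i < j)%N -> (j < i + p)%N ->
    u \is a GRing.unit -> w \is a GRing.unit ->
    mulT A B i P = scale3 u (x, y, 1) -> mulT A B j P = scale3 w (x', y', 1) ->
  pi x = pi x' -> pi y = pi y' -> False.
Proof.
move=> lij ljp hu hw ei ej ex ey; apply: (map3_distinct i j lij ljp).
rewrite ei ej; apply: (@proportional_trans _ (map3 R F pi (x, y, 1))).
  by apply: proportional_sym; apply: map3_proportional; exists u.
have -> : map3 R F pi (x, y, 1) = map3 R F pi (x', y', 1) by rewrite /map3 /= ex ey.
by apply: map3_proportional; exists w.
Qed.

Lemma mulT1 : mulT A B 1 P = P.
Proof. by rewrite mulTS /mulT /= /addT law1_O /unimod unitr1 !orbT. Qed.

(** The function a + y b has divisor j(P) + (-jP) - (j+1)(O). Its pole order gives the size bounds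
    and its norm the second equation; a(x) = y b(x) is the zero at -(jP). The last clause says that
    it does not vanish at -P, so that the zeros above x0 all sit at P. *)
Definition miller_data j u x y (a b : {poly R}) :=
  [/\ u \is a GRing.unit, mulT A B j P = scale3 u (x, y, 1),
      y ^+ 2 = x ^+ 3 + A * x + B &
   [/\ (2 * size a <= j + 3)%N /\ (2 * size b <= j)%N,
      a ^+ 2 - f * b ^+ 2 = (-1) ^+ j.+1 * ('X - x0%:P) ^+ j * ('X - x%:P),
      a.[x] = y * b.[x] & a.[x0] - y0 * b.[x0] \is a GRing.unit]].

Lemma unit2 : (2 : R) \is a GRing.unit.
Proof. by rewrite unitE rmorph_nat. Qed.

Lemma curve_of_line l x1 x2 :
    f - linep _ x0 y0 l ^+ 2 = ('X - x0%:P) * ('X - x1%:P) * ('X - x2%:P) ->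
  (- (y0 + l * (x2 - x0))) ^+ 2 = x2 ^+ 3 + A * x2 + B.
Proof.
move=> /(congr1 (horner^~ x2)).
rewrite hornerD hornerN horner_exp horner_linep horner_wpoly !hornerE subrr mulr0.
by move/subr0_eq => ->; rewrite sqrrN.
Qed.

(** The induction starts at 2, with the tangent line y - L: for j = 1 the function X - x0 vanishes
    at -P, against the last clause of [miller_data]. *)
Lemma miller_data2 : exists u x y a b, miller_data 2 u x y a b.
Proof.
have h2y : 2 * y0 \is a GRing.unit by rewrite unitrMl ?unit2.
pose l := (3 * x0 ^+ 2 + A) / (2 * y0).
have hl : l * (2 * y0) = 3 * x0 ^+ 2 + A by rewrite divrK.
have hL := wpoly_tangent _ _ _ _ _ _ c0 hl.
set x2 := l ^+ 2 - x0 - x0 in hL.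
pose L := linep _ x0 y0 l.
exists (8 * y0 ^+ 3), x2, (- (y0 + l * (x2 - x0))), (- L), 1; split.
- have -> : 8 * y0 ^+ 3 = (2 * y0) ^+ 3 by ring.
  by rewrite unitrX.
- rewrite mulTS mulT1 /addT /P law1_double law2_double /unimod unitr0 /=.
  exact: (law3_double _ _ _ _ _ _ c0 hl).
- exact: curve_of_line hL.
split.
- rewrite size_polyN size_poly1; split => //.
  by rewrite (leq_trans (leq_mul (leqnn 2) (size_linep _ x0 y0 l))).  
- rewrite expr1n mulr1 (_ : (- L) ^+ 2 - f = - (f - L ^+ 2)); last by ring.
  by rewrite hL; ring.
- by rewrite hornerN horner_linep hornerC mulr1.
- rewrite hornerN horner_linep hornerC mulr1 subrr mulr0 addr0.
  by rewrite (_ : - y0 - y0 = - (2 * y0)) ?unitrN //; ring.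
Qed.

Lemma pi_sq_eq (y y' : F) : y ^+ 2 = y' ^+ 2 -> y = y' \/ y = - y'.
Proof. by move/eqP; rewrite eqf_sqr => /orP [] /eqP; [left | right]. Qed.

(** Modulo p, jP is P or -P, and the former is excluded by 1 < j < p. *)
Lemma same_abscissa j u x y : (1 < j)%N -> (j < p)%N -> u \is a GRing.unit ->
    mulT A B j P = scale3 u (x, y, 1) -> y ^+ 2 = x ^+ 3 + A * x + B ->
    pi x = pi x0 -> pi y = - pi y0.
Proof.
move=> j1 jp hu hj c1 ex.
have : pi y ^+ 2 = pi y0 ^+ 2.
  by rewrite -!rmorphXn c1 c0 !(rmorphD, rmorphM, rmorphXn) ex.
case/pi_sq_eq => // ey; case: (@affine_distinct 1 j 1 u x0 y0 x y) => //.
- by rewrite ltnW // addnC addn1.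
- exact: unitr1.
- by rewrite mulT1 scale3_1.
Qed.

Lemma pi_law1_opp x y : y ^+ 2 = x ^+ 3 + A * x + B -> pi x = pi x0 -> pi y = - pi y0 ->
  map3 R F pi (law1 A B P (x, y, 1)) = (0, 8 * pi y0 ^+ 3, 0).
Proof.
move=> c1 ex ey.
have -> : map3 R F pi (law1 A B P (x, y, 1)) =
    law1 (pi A) (pi B) (pi x0, pi y0, 1) (pi x, pi y, 1).
  by rewrite /law1 /map3 /P /=; congr (_, _, _); ring.
by rewrite ex ey law1_opp // -!rmorphXn c0 !(rmorphD, rmorphM, rmorphXn).
Qed.

Lemma y0_cube_neq0 : 8 * pi y0 ^+ 3 != 0.
Proof.
have -> : 8 * pi y0 ^+ 3 = (2 * pi y0) ^+ 3 by ring.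
by rewrite expf_neq0 // mulf_neq0 // -unitE.
Qed.

Lemma addT_vertical x y : y ^+ 2 = x ^+ 3 + A * x + B -> pi x = pi x0 -> pi y = - pi y0 ->
  addT A B P (x, y, 1) = law1 A B P (x, y, 1).
Proof.
move=> c1 ex ey; rewrite /addT.
have := pi_law1_opp _ _ c1 ex ey; case: (law1 A B P (x, y, 1)) => [[X Y] Z].
by rewrite /map3 /= => -[_ eY _]; rewrite !unitE eY y0_cube_neq0 !orbT.
Qed.

Lemma addT_chord x y l : y ^+ 2 = x ^+ 3 + A * x + B -> l * (x - x0) = y - y0 ->
    x - x0 \is a GRing.unit ->
  let x2 := l ^+ 2 - x0 - x in
  addT A B P (x, y, 1) = scale3 ((x - x0) ^+ 3) (x2, - (y0 + l * (x2 - x0)), 1).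
Proof.
move=> c1 hl hd x2; rewrite /addT /P (law1_chord _ _ _ _ _ _ _ _ c0 c1 hl) -/x2.
by rewrite /unimod /scale3 mulr1 unitrX // !orbT.
Qed.

Lemma miller_dataS j u x y a b : (1 < j)%N -> (j.+1 < p)%N ->
  miller_data j u x y a b -> exists u' x' y' a' b', miller_data j.+1 u' x' y' a' b'.
Proof.
move=> j1 jp [hu hj c1 [[sa sb] hn hv hw]].
(* Otherwise jP reduces to -P and (j+1)P to O, too early since j + 1 < p. *)
have hd : x - x0 \is a GRing.unit.
  rewrite unitE; apply/negP => /eqP; rewrite rmorphB => /subr0_eq ex.
  have ey := same_abscissa _ _ _ _ j1 (ltnW jp) hu hj c1 ex.
  apply: (map3_distinct 0 j.+1) => //.
  rewrite mulTS hj addT_scaler // addT_vertical // /mulT /= map3_O.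
  have hu2 : u ^+ 2 \is a GRing.unit by rewrite unitrX.
  apply: (@proportional_trans _ (map3 R F pi (law1 A B P (x, y, 1)))).
    rewrite pi_law1_opp //; exists (8 * pi y0 ^+ 3); first by rewrite unitfE y0_cube_neq0.
    by rewrite /scale3 /= mulr0 mulr1.
  by apply: map3_proportional; exists (u ^+ 2).
pose l := (y - y0) / (x - x0).
have hl : l * (x - x0) = y - y0 by rewrite divrK.
have hL := wpoly_chord _ _ _ _ _ _ _ _ c0 c1 hl hd.
have hadd := addT_chord _ _ _ c1 hl hd.
set x2 := l ^+ 2 - x0 - x in hL hadd.
set y2 := - (y0 + l * (x2 - x0)) in hadd.
have hu' : u ^+ 2 * (x - x0) ^+ 3 \is a GRing.unit by rewrite unitrMl unitrX.
have hj' : mulT A B j.+1 P = scale3 (u ^+ 2 * (x - x0) ^+ 3) (x2, y2, 1).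
  by rewrite mulTS hj addT_scaler // hadd scale3A.
(* jP and (j+1)P are distinct modulo p, so one of their coordinates differs by a unit, as
   [miller_step] requires. *)
have hor : (x2 - x \is a GRing.unit) || (y - y2 \is a GRing.unit).
  rewrite !unitE [pi (x2 - x)]rmorphB [pi (y - y2)]rmorphB -negb_and.
  apply/negP => /andP [].
  rewrite !subr_eq0 => /eqP ex /eqP ey.
  apply: (affine_distinct j j.+1 _ _ _ _ _ _ _ _ hu hu' hj hj') => //.
  by rewrite -addn1 ltn_add2l prime_gt1.
have hy : y = y0 + l * (x - x0) by rewrite hl addrC subrK.
have [a' [b' [ha' hb' hv']]] := miller_step _ _ _ _ _ _ _ _ _ _ _ _ hL hy erefl hor hv.
exists (u ^+ 2 * (x - x0) ^+ 3), x2, y2, a', b'; split => //; first exact: curve_of_line hL.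
split => //.
- have sf := size_wpoly _ A B; have sL := size_linep _ x0 y0 l.
  have [t1 t2] := miller_sizes _ _ _ _ _ j1 sa sb sf sL.
  have u1 : (size a' <= (j + 4)./2)%N.
    apply: (size_divXsubC _ _ _ _ _ ha').
    apply: leq_trans (size_polyD _ _) (leq_trans _ t1); rewrite size_polyN geq_max !leq_max.
    by rewrite !size_polyMleq orbT.
  have u2 : (size b' <= j.+1./2)%N.
    apply: (size_divXsubC _ _ _ _ _ hb').
    apply: leq_trans (size_polyD _ _) (leq_trans _ t2); rewrite size_polyN geq_max !leq_max.
    by rewrite leqnn size_polyMleq orbT.
  split.
    by apply: leq_trans (leq_mul (leqnn 2) u1) _; clear; lia.
  by apply: leq_trans (leq_mul (leqnn 2) u2) _; clear; lia.
(* Multiplicativity of the norm: y - L has norm L^2 - f, and the factor (X - x)^2 coming from the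
   division is cancelled. *)
- apply: (@XsubC_cancel _ x); apply: (@XsubC_cancel _ x).
  transitivity ((('X - x%:P) * a') ^+ 2 - f * (('X - x%:P) * b') ^+ 2); first by ring.
  rewrite ha' hb' -/f; set L := linep _ x0 y0 l in hL *.
  transitivity (- (a ^+ 2 - f * b ^+ 2) * (f - L ^+ 2)); first by ring.
  by rewrite hn hL !exprS; ring.
(* At -P the factor y - L takes the value -2 y0, a unit, so the new function does not vanish there
   either. *)
- have ea := congr1 (horner^~ x0) ha'; have eb := congr1 (horner^~ x0) hb'.
  rewrite /= hornerM hornerXsubC hornerD hornerN 2!hornerM horner_linep horner_wpoly -c0 in ea.
  rewrite /= hornerM hornerXsubC hornerD hornerN hornerM horner_linep in eb.
  rewrite subrr mulr0 addr0 in ea eb.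
  have hd' : x0 - x \is a GRing.unit by rewrite -unitrN opprB.
  have e : (x0 - x) * (a'.[x0] - y0 * b'.[x0]) = - (2 * y0 * (a.[x0] - y0 * b.[x0])).
    by rewrite mulrBr ea mulrCA eb; ring.
  by rewrite -(unitrMr _ hd') e unitrN !unitrMl // unit2.
Qed.

Lemma miller_dataP j : (1 < j)%N -> (j < p)%N -> exists u x y a b, miller_data j u x y a b.
Proof.
elim: j => // j ih j1 jp; have [j0|j2] := ltnP 1 j; last first.
  have -> : j = 1%N by clear -j1 j2; lia.
  exact: miller_data2.
have [u [x [y [a [b h]]]]] := ih j0 (ltnW jp).
exact: miller_dataS h.
Qed.

(** At j = p - 1 the extra zero -(jP) is P itself. This takes (p-1)P = -P exactly over R, which is
    what torsion over R gives beyond torsion over F. *)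
Lemma miller_function : exists a b : {poly R},
  [/\ (2 * size a <= p.+1)%N,
      a ^+ 2 - f * b ^+ 2 = - ('X - x0%:P) ^+ p,
      a.[x0] = - y0 * b.[x0] & b.[x0] \is a GRing.unit].
Proof.
have p1 : (1 < p.-1)%N by lia.
have pp : (p.-1 < p)%N by lia.
have p_gt0 : (0 < p)%N by lia.
have odd_p : odd p by have := even_prime p_prime; clear -p_gt2; lia.
have [u [x [y [a [b [hu hj c1 [[sa sb] hn hv hw]]]]]]] := miller_dataP _ p1 pp.
have [w hw' ep] := pP_O; rewrite -(prednK p_gt0) mulTS hj addT_scaler // in ep.
have hu2 : u ^+ 2 \is a GRing.unit by rewrite unitrX.
(* If x - x0 were a unit, the sum would be an affine point given by the chord, hence not O. *)
have ex : pi x = pi x0.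
  apply/eqP; rewrite -subr_eq0 -rmorphB; apply/negPn; rewrite -unitE; apply/negP => hd.
  have hl : (y - y0) / (x - x0) * (x - x0) = y - y0 by rewrite divrK.
  move: ep; rewrite (addT_chord _ _ _ c1 hl hd) scale3A /scale3 /pt_O mulr0 mulr1 => -[_ _ e].
  have : u ^+ 2 * (x - x0) ^+ 3 \is a GRing.unit by rewrite unitrMl unitrX.
  by rewrite e unitr0.
have ey := same_abscissa _ _ _ _ p1 pp hu hj c1 ex.
have exx : x = x0.
  have := law1_vertical _ A B _ _ _ _ c0 c1.
  move: ep; rewrite addT_vertical // /P; case: (law1 _ _ _ _) => [[X Y] Z].
  rewrite /scale3 /pt_O /= mulr0 => -[eX _ _].
  have -> : X = 0 by apply: (mulrI hu2); rewrite eX mulr0.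
  have hq : (y - y0) ^+ 2 - (x0 + x) * (x - x0) ^+ 2 \is a GRing.unit.
    rewrite unitE rmorphB rmorphXn (rmorphM pi (x0 + x)) rmorphXn !rmorphB ex ey subrr expr0n /= mulr0 subr0.
    rewrite (_ : - pi y0 - pi y0 = - (2 * pi y0)); last by ring.
    by rewrite sqrrN expf_neq0 // mulf_neq0 // -unitE.
  by move=> e; apply/subr0_eq; apply: (mulIr hq); rewrite -e mul0r.
have eyy : y = - y0.
  apply/eqP; rewrite -addr_eq0; apply/eqP.
  have hq : y - y0 \is a GRing.unit.
    rewrite unitE rmorphB ey (_ : - pi y0 - pi y0 = - (2 * pi y0)); last by ring.
    by rewrite oppr_eq0 mulf_neq0 // -unitE.
  apply: (mulrI hq); rewrite mulr0.
  transitivity (y ^+ 2 - y0 ^+ 2); first by ring.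
  by rewrite c1 c0 exx subrr.
have hv0 : a.[x0] = - y0 * b.[x0] by rewrite -eyy -{1}exx hv exx.
exists a, b; split => //.
- by clear -sa odd_p; lia.
- rewrite hn exx -mulrA -exprSr prednK // -signr_odd odd_p.
  by rewrite expr1 mulN1r.
- move: hw; rewrite hv0 (_ : - y0 * b.[x0] - y0 * b.[x0] = - (2 * y0 * b.[x0])); last by ring.
  by rewrite unitrN unitrMr // unitrMr // unit2.
Qed.

End Miller.

(** * The norm equation and its rigidity *)

Section NormEquation.
Variables (F : fieldType) (p : nat).
Hypothesis charFp : p \in [pchar F].
Hypothesis p_gt3 : (3 < p)%N.
Hypothesis frobenius_id : forall c : F, c ^+ p = c.
Variables (A B x0 y0 : F).
Let f := wpoly F A B.
Hypothesis y0_neq0 : y0 != 0.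

Lemma size_mulF (q r : {poly F}) : q != 0 -> r != 0 -> size (q * r) = (size q + size r).-1.
Proof. exact: size_mul. Qed.

(* lia sees [size q] at different but convertible structure instances as distinct atoms; [degp]
   normalizes them. *)
Definition degp (q : {poly F}) := size q.

Lemma degpE (q : {poly F}) : size q = degp q.
Proof. by []. Qed.

Lemma size_polyMleqF (q r : {poly F}) : (size (q * r)%R <= (size q + size r).-1)%N.
Proof. exact: size_polyMleq. Qed.

Lemma size_polyDF (q r : {poly F}) : (size (q + r)%R <= maxn (size q) (size r))%N.
Proof. exact: size_polyD. Qed.

Lemma natr_lt_neq0 i : (0 < i)%N -> (i < p)%N -> i%:R != 0 :> F.
Proof.
move=> i0 ip; rewrite -(dvdn_pcharf charFp); apply/negP => /dvdn_leq.
by move=> /(_ i0); rewrite leqNgt ip.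
Qed.

Lemma two_neq0 : 2 != 0 :> F.
Proof. by apply: natr_lt_neq0 => //; apply: ltn_trans p_gt3. Qed.

Lemma three_neq0 : 3 != 0 :> F.
Proof. exact: natr_lt_neq0. Qed.

Lemma size_wpolyF : size f = 4%N.
Proof.
rewrite /f /wpoly -addrA size_polyDl size_polyXn //.
apply: leq_ltn_trans (size_polyD _ _) _; rewrite gtn_max.
rewrite (leq_ltn_trans (size_polyC_leq1 _)) // andbT.
apply: leq_ltn_trans (size_polyMleqF _ _) _; rewrite size_polyX size_polyC.
by case: (A != 0).
Qed.

Lemma wpoly_monic : f \is monic.
Proof.
rewrite monicE lead_coefE size_wpolyF /f /wpoly !coefD coefXn coefC /=.
by rewrite coefMX coefC /= !addr0.
Qed.

Lemma wpoly_neq0 : f != 0.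
Proof. by rewrite monic_neq0 ?wpoly_monic. Qed.

Definition norm_solution (a b : {poly F}) :=
  [/\ (2 * size a <= p.+1)%N, a ^+ 2 - f * b ^+ 2 = - ('X - x0%:P) ^+ p & b.[x0] != 0].

(** A common divisor divides (X - x0)^p, so it is a power of X - x0, and X - x0 does not divide
    b. *)
Lemma norm_solution_coprime a b : norm_solution a b -> coprimep a b.
Proof.
case=> _ hN hb; apply/coprimepP => d da db.
have : d %| ('X - x0%:P) ^+ p.
  rewrite -[X in d %| X]opprK -hN dvdpNr; apply: dvdp_sub.
    by rewrite expr2 dvdp_mulr.
  by rewrite expr2 mulrA dvdp_mull.
case/dvdp_exp_XsubCP => -[|k] _ hd //.
case/negP: hb; rewrite -[_ == 0]/(root b x0) root_factor_theorem.
apply: dvdp_trans db; rewrite (eqp_dvdr _ hd).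
by rewrite exprS dvdp_mulr.
Qed.

(** In f b^2 = (X - x0)^p + a^2 the size bound on a makes the first term dominate, so 3 + 2 deg b =
    p. *)
Lemma norm_solution_size a b : norm_solution a b -> (2 * size b = p.-1)%N.
Proof.
case=> sa hN hb; have b0 : b != 0 by apply: contraNneq hb => ->; rewrite horner0.
have e : f * b ^+ 2 = ('X - x0%:P) ^+ p + a ^+ 2 by rewrite -[_ ^+ p]opprK -hN; ring.
have /(congr1 (fun q : {poly F} => size q)) := e.
rewrite size_polyDl; last first.
  rewrite size_exp_XsubC expr2; apply: leq_ltn_trans (size_polyMleqF _ _) _.
  by move: (sa) (p_gt3); rewrite !degpE; clear; lia.
rewrite size_exp_XsubC expr2 !size_mulF ?mulf_neq0 ?wpoly_neq0 // size_wpolyF.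
have : (0 < size b)%N by rewrite size_poly_gt0.
by rewrite !degpE; clear; lia.
Qed.

(** In the factorization of a^2 b'^2 - a'^2 b^2, the values at x0 make a b' + a' b prime to X - x0,
    so (X - x0)^p divides a b' - a' b, which has degree below p and hence is zero. Coprimality then
    leaves a constant factor, of square 1. *)
Lemma norm_solution_unique a b a' b' : norm_solution a b -> norm_solution a' b' ->
    a.[x0] = - y0 * b.[x0] -> a'.[x0] = - y0 * b'.[x0] ->
  exists c, [/\ c = 1 \/ c = -1, a' = c%:P * a & b' = c%:P * b].
Proof.
move=> s s' hv hv'; have cop := norm_solution_coprime _ _ s.
have sb := norm_solution_size _ _ s; have sb' := norm_solution_size _ _ s'.
have [sa hN hb] := s; have [sa' hN' hb'] := s'.
have e : (a * b' - a' * b) * (a * b' + a' * b) = ('X - x0%:P) ^+ p * (b ^+ 2 - b' ^+ 2).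
  transitivity ((a ^+ 2 - f * b ^+ 2) * b' ^+ 2 - (a' ^+ 2 - f * b' ^+ 2) * b ^+ 2); first by ring.
  by rewrite hN hN'; ring.
have h0 : a * b' - a' * b = 0.
  apply/eqP; rewrite -size_poly_leq0 leqNgt; apply/negP => hs.
  have : ('X - x0%:P) ^+ p %| a * b' - a' * b.
    have cp : coprimep (('X - x0%:P) ^+ p) (a * b' + a' * b).
      rewrite coprimep_pexpl; last by apply: leq_trans p_gt3.
      rewrite coprimep_sym coprimep_XsubC /root !hornerE hv hv'.
      have -> : - y0 * b.[x0] * b'.[x0] + - y0 * b'.[x0] * b.[x0] = - (2 * (y0 * (b.[x0] * b'.[x0]))).
        by ring.
      by rewrite oppr_eq0 !mulf_neq0 // two_neq0.
    by rewrite -(Gauss_dvdpl _ cp) e dvdp_mulr.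
  move/dvdp_leq; rewrite -size_poly_gt0 hs => /(_ isT).
  rewrite size_exp_XsubC => h.
  have := leq_trans h (size_polyDF _ _); rewrite size_polyN leq_max => /orP [] h1.
    by have := leq_trans h1 (size_polyMleqF _ _); move: (sa) (sb') (p_gt3); rewrite !degpE; clear; lia.
  by have := leq_trans h1 (size_polyMleqF _ _); move: (sa') (sb) (p_gt3); rewrite !degpE; clear; lia.
move/subr0_eq in h0.
have : b %| b'.
  have cp : coprimep b a by rewrite coprimep_sym.
  by rewrite -(Gauss_dvdpr _ cp) h0 dvdp_mull.
have b0 : b != 0 by apply: contraNneq hb => ->; rewrite horner0.
have b'0 : b' != 0 by apply: contraNneq hb' => ->; rewrite horner0.
move=> hq; have [q eb] : exists q : {poly F}, b' = q * b by apply/dvdpP.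
have q0 : q != 0 by apply: contraNneq b'0 => q0; rewrite eb q0 mul0r.
have sq : size q = 1%N.
  have := congr1 (fun r : {poly F} => size r) eb; rewrite /= size_mulF //.
  have : (0 < size q)%N by rewrite size_poly_gt0.
  have : (0 < size b)%N by rewrite size_poly_gt0.
  by move: (sb) (sb'); rewrite !degpE; clear; lia.
have [c c_neq0 ec] : exists2 c, c != 0 & q = c%:P by apply/size_poly1P/eqP.
have ea : a' = c%:P * a.
  apply: (mulIf b0); rewrite -h0 eb ec; ring.
have ec2 : (c ^+ 2)%:P = 1 :> {poly F}.
  apply: (@mulIf _ (a ^+ 2 - f * b ^+ 2)).
    by rewrite hN oppr_eq0 expf_neq0 // polyXsubC_eq0.
  rewrite mul1r [RHS]hN -hN' ea eb ec; ring.
exists c; split=> //; last by rewrite eb ec.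
have : c ^+ 2 == 1 by rewrite -(inj_eq (@polyC_inj F)) ec2.
by rewrite sqrf_eq1 => /orP [] /eqP; [left | right].
Qed.

Hypothesis A_neq0 : A != 0.

Lemma deriv_wpoly : f^`() = 3%:P * 'X ^+ 2 + A%:P.
Proof. by rewrite /f /wpoly !derivE; ring. Qed.

Lemma wpoly_not_cube r : f != ('X - r%:P) ^+ 3.
Proof.
apply/negP => /eqP e.
have e' : f = 'X ^+ 3 - (3 * r)%:P * 'X ^+ 2 + (3 * r ^+ 2)%:P * 'X - (r ^+ 3)%:P.
  by rewrite e; ring.
have := congr1 (fun q : {poly F} => q`_2) e'; have := congr1 (fun q : {poly F} => q`_1) e'.
rewrite /f /wpoly !(coefD, coefN, coefCM, coefXn, coefC, coefX) /= !(mulr0, mulr1, addr0, add0r, subr0).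
move=> e1 /esym /eqP; rewrite oppr_eq0 mulf_eq0 (negPf three_neq0) /= => /eqP r0.
by move: A_neq0; rewrite e1 r0 oppr0 add0r expr2 !mulr0 eqxx.
Qed.

(** If the derivative vanished, a would be a constant c, its degree being below p; since c^p = c, f
    b^2 would be the p-th power of X - (x0 - c^2) and f the cube of that linear polynomial, which A
    != 0 forbids. *)
Lemma norm_solution_nonconst a b : norm_solution a b -> a^`() != 0.
Proof.
move=> s; have [sa hN hb] := s; apply/negP => /eqP da.
have /size1_polyC ea : (size a <= 1)%N.
  apply/leq_sizeP => -[//|j] _; have [jp|pj] := ltnP j.+1 p.
    have /eqP := congr1 (fun q : {poly F} => q`_j) da; rewrite coef_deriv coef0.
    by rewrite -mulr_natr mulf_eq0 (negPf (natr_lt_neq0 _ _ jp)) // orbF => /eqP.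
  by apply: nth_default; move: (sa) (pj) (p_gt3); rewrite !degpE; clear; lia.
set c := a`_0 in ea.
have e : f * b ^+ 2 = ('X - (x0 - c ^+ 2)%:P) ^+ p.
  have -> : 'X - (x0 - c ^+ 2)%:P = ('X - x0%:P) + (c ^+ 2)%:P by ring.
  have charP : p \in [pchar {poly F}] by rewrite pchar_poly.
  rewrite -(pFrobenius_autE charP) rmorphD /= !pFrobenius_autE.
  rewrite -rmorphXn /= frobenius_id -[X in X + _]opprK -hN ea; ring.
have : f %| ('X - (x0 - c ^+ 2)%:P) ^+ p by rewrite -e dvdp_mulr.
case/dvdp_exp_XsubCP => k _ hk.
have /eqP ek : k == 3%N by have := eqp_size hk; rewrite size_wpolyF size_exp_XsubC => -[<-].
have : f == ('X - (x0 - c ^+ 2)%:P) ^+ 3.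
  by rewrite -eqp_monic ?wpoly_monic ?monic_exp ?monicXsubC // -ek.
by rewrite (negPf (wpoly_not_cube _)).
Qed.

(* A first-order deformation B + e tau of the curve along which the solution (a, b) of the norm
   equation deforms to (a + e al, b + e be) is trivial. *)
Lemma norm_solution_rigid (a b al be : {poly F}) (tau : F) : norm_solution a b -> (2 * size al <= p.+1)%N ->
  2 * (a * al - f * b * be) = tau%:P * b ^+ 2 -> tau = 0.
Proof.
move=> s sal hE; have cop := norm_solution_coprime _ _ s.
have sb := norm_solution_size _ _ s; have nc := norm_solution_nonconst _ _ s.
have [sa hN hb] := s.
have b0 : b != 0 by apply: contraNneq hb => ->; rewrite horner0.
pose h : {poly F} := (2^-1)%:P.
have hh : h * 2 = 1.
  by rewrite /h -[2]/(2%:R) -polyC_natr -polyCM mulVf ?two_neq0.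
(* Derivative of the norm equation; its right side is, up to sign, a p-th power and contributes
   nothing. *)
have dN : 2 * (a * a^`()) = b * (f^`() * b + 2 * f * b^`()).
  have d0 : (('X - x0%:P) ^+ p)^`() = 0.
    by rewrite deriv_exp -scaler_nat (pcharf0 charFp) scale0r.
  have := congr1 (@deriv F) hN; rewrite derivN d0 oppr0 !expr2 derivB !derivM => e.
  apply: (@eq_from_sub _ _ _ _ _ e); ring.
have dvd_b (q r : {poly F}) : 2 * (a * q) = b * r -> b %| q.
  have cp : coprimep b a by rewrite coprimep_sym.
  move=> e; rewrite -(Gauss_dvdpr _ cp).
  have -> : a * q = b * (h * r).
    transitivity ((h * 2) * (a * q)); first by rewrite hh mul1r.
    by rewrite -mulrA e; ring.
  by rewrite dvdp_mulr.
(* Coprimality with a makes b divide both [al] and the derivative of a; the size bounds then leave a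
   quotient l of degree at most 1 and a constant t. *)
have [l el] : exists l : {poly F}, al = l * b.
  apply/dvdpP.
  apply: (dvd_b _ (tau%:P * b + 2 * f * be)).
  transitivity (2 * (a * al - f * b * be) + 2 * f * b * be); first by ring.
  by rewrite hE; ring.
have [t et] : exists t : {poly F}, a^`() = t * b by apply/dvdpP; exact: dvd_b dN.
have l2 : (size l <= 2)%N.
  have [->|l0] := eqVneq l 0; first by rewrite size_poly0.
  have := congr1 (fun q : {poly F} => size q) el; rewrite /= size_mulF //.
  have : (0 < size b)%N by rewrite size_poly_gt0.
  by move: (sal) (sb); rewrite !degpE; clear; lia.
have /size1_polyC et1 : (size t <= 1)%N.
  have [->|t0] := eqVneq t 0; first by rewrite size_poly0.
  have := congr1 (fun q : {poly F} => size q) et; rewrite /= size_mulF //.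
  have : (0 < size b)%N by rewrite size_poly_gt0.
  have a0 : a != 0 by apply: contraNneq nc => ->; rewrite derivC.
  have := lt_size_deriv a0; move: (sa) (sb); rewrite !degpE; clear; lia.
set s0 := t`_0 in et1.
have s0_neq0 : s0 != 0 by apply: contraNneq nc => e; rewrite et et1 e mul0r.
(* Together with [et], this says that the logarithmic differential of a + y b is s0 dx/y. *)
have key1 : 2 * a * s0%:P = f^`() * b + 2 * f * b^`().
  by apply: (mulfI b0); rewrite -dN et et1; ring.
have key2 : 2 * (a * l - f * be) = tau%:P * b.
  apply: (mulfI b0); transitivity (2 * (a * al - f * b * be)); first by rewrite el; ring.
  by rewrite hE; ring.
(* Elimination of a between [key1] and [key2]. As f is prime to b, it divides a polynomial of degree
   at most 3, which is therefore a constant multiple k0 f. *)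
have key3 : f * (2 * (b^`() * l - be * s0%:P)) = b * (tau%:P * s0%:P - l * f^`()).
  transitivity (2 * a * s0%:P * l - 2 * f * be * s0%:P - f^`() * b * l).
    by rewrite key1; ring.
  transitivity (2 * (a * l - f * be) * s0%:P - f^`() * b * l); first by ring.
  by rewrite key2; ring.
have cfb : coprimep f b.
  apply/coprimepP => d df db; have /coprimepP := cop; apply => //.
  have : d %| 2 * a * s0%:P by rewrite key1 dvdp_add ?(dvdp_mull _ db) // mulrAC dvdp_mull.
  have -> : 2 * a * s0%:P = (2 * s0) *: a by rewrite -mul_polyC; ring.
  by rewrite dvdpZr // mulf_neq0 // two_neq0.
have [k ek] : exists k : {poly F}, tau%:P * s0%:P - l * f^`() = k * f.
  apply/dvdpP.
  by rewrite -(Gauss_dvdpr _ cfb) -key3 dvdp_mulr.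
have [l1 [l0 el01]] : exists l1 l0, l = l1%:P * 'X + l0%:P.
  exists l`_1, l`_0; apply/polyP => -[|[|i]]; rewrite !(coefD, coefCM, coefX, coefC) /=.
  - by rewrite mulr0 add0r.
  - by rewrite mulr1 addr0.
  - by rewrite mulr0 addr0; apply: nth_default; apply: leq_trans l2 _.
have eg : tau%:P * s0%:P - l * f^`() =
    - (3 * l1)%:P * 'X ^+ 3 - (3 * l0)%:P * 'X ^+ 2 - (l1 * A)%:P * 'X + (tau * s0 - l0 * A)%:P.
  by rewrite deriv_wpoly el01; ring.
have [k0 ek0] : exists k0, k = k0%:P.
  exists k`_0; apply: size1_polyC.
  have [->|kn0] := eqVneq k 0; first by rewrite size_poly0.
  have := congr1 (fun q : {poly F} => size q) ek; rewrite /= eg size_mulF ?wpoly_neq0 // size_wpolyF.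
  set g := (X in size X = _ -> _); have : (size g <= 4)%N.
    apply/leq_sizeP => -[|[|[|[|i]]]] // _.
    by rewrite /g !(coefD, coefN, coefCM, coefXn, coefX, coefC) /= -polyCN coefCM coefXn /= !mulr0 !subr0 addr0.
  by rewrite !degpE; clear; lia.
move: ek; rewrite eg ek0 => ek.
(* The coefficients give 3 l0 = 0, k0 = -3 l1 and k0 A = -l1 A, hence 2 l1 A = 0; since A is
   nonzero, l vanishes and tau s0 = 0 remains. *)
have cf i := congr1 (fun q : {poly F} => q`_i) ek.
have := cf 3%N; have := cf 2%N; have := cf 1%N; have := cf 0%N.
rewrite /f /wpoly -!polyCN !(coefD, coefN, coefCM, coefXn, coefX, coefC) /= .
rewrite !(mulr0, mulr1, addr0, add0r, subr0, oppr0) => e0 e1 e2 e3.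
have l0_0 : l0 = 0.
  by move/eqP: e2; rewrite oppr_eq0 mulf_eq0 (negPf three_neq0) => /eqP.
have l1_0 : l1 = 0.
  have : 2 * (l1 * A) = 0.
    apply: (@eq_from_sub _ _ _ (- (l1 * A) - k0 * A)); first by rewrite -e3; ring.
    by rewrite -e1; ring.
  by move/eqP; rewrite !mulf_eq0 (negPf two_neq0) (negPf A_neq0) /= orbF => /eqP.
move: e0; rewrite -e3 l0_0 l1_0 mulr0 oppr0 !mul0r subr0 => /eqP.
by rewrite mulf_eq0 (negPf s0_neq0) orbF => /eqP.
Qed.

End NormEquation.

(** * Rigidity over a ring with square-zero ideal (e), modelled on Z/p^2 with e = p *)

Section Rigidity.
Variables (R : comUnitRingType) (F : fieldType) (pi : {rmorphism R -> F}).
Hypothesis unitE : forall x, (x \is a GRing.unit) = (pi x != 0).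
Variables (e : R) (g : R -> R).
Hypothesis e_sq : e * e = 0.
Hypothesis kerE : forall x, pi x = 0 -> x = e * g x.
Hypothesis annE : forall x, e * x = 0 -> pi x = 0.
Variable p : nat.
Hypothesis charFp : p \in [pchar F].
Hypothesis p_gt3 : (3 < p)%N.
Hypothesis frobenius_id : forall c : F, c ^+ p = c.

Lemma ker_poly (q : {poly R}) : map_poly pi q = 0 ->
  exists2 r : {poly R}, q = e%:P * r & (size r <= size q)%N.
Proof.
move=> hq; exists (\poly_(i < size q) g q`_i); last exact: size_poly.
apply/polyP => i; rewrite coefCM coef_poly; case: ltnP => hi.
  apply: kerE; have := congr1 (fun r : {poly F} => r`_i) hq.
  by rewrite coef_map coef0.
by rewrite mulr0 nth_default.
Qed.

Lemma ann_poly (q : {poly R}) : e%:P * q = 0 -> map_poly pi q = 0.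
Proof.
move=> hq; apply/polyP => i; rewrite coef_map coef0; apply: annE.
by rewrite -coefCM hq coef0.
Qed.

Lemma map_wpoly A B : map_poly pi (wpoly R A B) = wpoly F (pi A) (pi B).
Proof.
by rewrite /wpoly !rmorphD rmorphM /= map_polyXn !map_polyC map_polyX.
Qed.

Lemma map_norm_form (w a b : {poly R}) : map_poly pi (a ^+ 2 - w * b ^+ 2) =
  map_poly pi a ^+ 2 - map_poly pi w * map_poly pi b ^+ 2.
Proof. by rewrite rmorphB /= rmorphXn (rmorphM _ w) /= rmorphXn. Qed.

Lemma map_deformation (f a b al be t : {poly R}) :
  map_poly pi (2 * (a * al - f * b * be) - t * b ^+ 2) =
  2 * (map_poly pi a * map_poly pi al - map_poly pi f * map_poly pi b * map_poly pi be)
    - map_poly pi t * map_poly pi b ^+ 2.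
Proof.
by rewrite !mulr_natl rmorphB rmorphMn (rmorphM _ t) /= rmorphXn rmorphB /= !rmorphM.
Qed.

Lemma map_norm_solution A B x0 (a b : {poly R}) : (2 * size a <= p.+1)%N ->
    a ^+ 2 - wpoly R A B * b ^+ 2 = - ('X - x0%:P) ^+ p -> b.[x0] \is a GRing.unit ->
  norm_solution F p (pi A) (pi B) (pi x0) (map_poly pi a) (map_poly pi b).
Proof.
move=> sa hN hb; split.
- by apply: leq_trans sa; rewrite leq_mul2l size_poly.
- have := congr1 (map_poly pi) hN.
  rewrite map_norm_form map_wpoly => ->.
  by rewrite rmorphN /= rmorphXn rmorphB /= map_polyX map_polyC.
- by rewrite horner_map -unitE.
Qed.

(** The difference of the two norm equations is e times the first-order deformation, the terms in
    e^2 being zero. Removing e lands in F, where [norm_solution_rigid] gives pi tau = 0; then B' - B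
    = e tau lies in (e^2) = 0. *)
Lemma rigid_lifts A B B' x0 (a b a' b' : {poly R}) : pi A != 0 -> pi B = pi B' ->
    (2 * size a <= p.+1)%N -> (2 * size a' <= p.+1)%N -> b.[x0] \is a GRing.unit ->
    map_poly pi a' = map_poly pi a -> map_poly pi b' = map_poly pi b ->
    a ^+ 2 - wpoly R A B * b ^+ 2 = - ('X - x0%:P) ^+ p ->
    a' ^+ 2 - wpoly R A B' * b' ^+ 2 = - ('X - x0%:P) ^+ p ->
    pi x0 ^+ 3 + pi A * pi x0 + pi B != 0 ->
  B = B'.
Proof.
move=> A0 eB sa sa' hb ea eb hN hN' f0.
have [al eal sal] : exists2 r : {poly R}, a' - a = e%:P * r & (size r <= size (a' - a)%R)%N.
  by apply: ker_poly; rewrite rmorphB /= ea subrr.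
have [be ebe _] : exists2 r : {poly R}, b' - b = e%:P * r & (size r <= size (b' - b)%R)%N.
  by apply: ker_poly; rewrite rmorphB /= eb subrr.
have ker_B : pi (B' - B) = 0 by rewrite rmorphB eB subrr.
have eB' := kerE _ ker_B; set tau := g (B' - B) in eB'.
have e_sqP : e%:P * e%:P = 0 :> {poly R} by rewrite -polyCM e_sq.
have ea' : a' = a + e%:P * al by rewrite -eal addrC subrK.
have eb' : b' = b + e%:P * be by rewrite -ebe addrC subrK.
have ef : wpoly R A B' = wpoly R A B + e%:P * tau%:P.
  by rewrite -polyCM -eB' /wpoly polyCB; ring.
set f := wpoly R A B in ef hN.
have key : e%:P * (2 * (a * al - f * b * be) - tau%:P * b ^+ 2) = 0.
  apply: (@eq_from_sub _ _ _ ((a' ^+ 2 - wpoly R A B' * b' ^+ 2) - (a ^+ 2 - f * b ^+ 2)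
    + (e%:P * e%:P) * (f * be ^+ 2 - al ^+ 2 + 2 * tau%:P * b * be + e%:P * tau%:P * be ^+ 2))).
    by rewrite ef ea' eb'; ring.
  by rewrite hN hN' subrr e_sqP mul0r addr0.
have /ann_poly := key; rewrite map_deformation map_wpoly map_polyC /=.
move/subr0_eq => key'.
have s := map_norm_solution _ _ _ _ _ sa hN hb.
have tau0 : pi tau = 0.
  apply: (norm_solution_rigid F p charFp p_gt3 frobenius_id _ _ _ A0 _ _
            (map_poly pi al) (map_poly pi be) _ s).
    apply: leq_trans (leq_mul (leqnn 2) (size_poly _ _)) _.
    apply: leq_trans (leq_mul (leqnn 2) sal) _.
    apply: leq_trans (leq_mul (leqnn 2) (size_polyD _ _)) _.
    by rewrite size_polyN maxnMr geq_max sa' sa.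
  exact: key'.
apply/esym/subr0_eq; rewrite eB' (kerE _ tau0) mulrA e_sq mul0r //.
Qed.

Lemma torsion_rigid A B B' x0 y0 y0' : prime p -> pi A != 0 -> pi B = pi B' ->
    y0 ^+ 2 = x0 ^+ 3 + A * x0 + B -> y0' ^+ 2 = x0 ^+ 3 + A * x0 + B' ->
    y0 \is a GRing.unit -> pi y0 = pi y0' ->
    proportional _ (pt_O R) (mulT A B p (x0, y0, 1)) ->
    proportional _ (pt_O R) (mulT A B' p (x0, y0', 1)) ->
  B = B'.
Proof.
move=> pp A0 eB c0 c0' uy ey tP tP'.
have two0 := two_neq0 F p charFp p_gt3.
have uy' : y0' \is a GRing.unit by rewrite unitE -ey -unitE.
have p_gt2 : (2 < p)%N by exact: ltnW.
have [a [b [sa hN hv hb]]] := miller_function _ _ _ unitE _ _ _ _ _ pp p_gt2 two0 c0 uy tP.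
have [a' [b' [sa' hN' hv' hb']]] := miller_function _ _ _ unitE _ _ _ _ _ pp p_gt2 two0 c0' uy' tP'.
have s := map_norm_solution _ _ _ _ _ sa hN hb.
have s' := map_norm_solution _ _ _ _ _ sa' hN' hb'; rewrite -eB in s'.
have pc0 : pi y0 ^+ 2 = pi x0 ^+ 3 + pi A * pi x0 + pi B.
  by rewrite -!rmorphXn -rmorphM -!rmorphD c0.
have py0 : pi y0 != 0 by rewrite -unitE.
have := norm_solution_unique F p charFp p_gt3 _ _ _ _ py0 _ _ _ _ s s'.
rewrite !horner_map hv hv' !rmorphM !rmorphN /= -ey => /(_ erefl erefl) [c [hc eca ecb]].
have f0 : pi x0 ^+ 3 + pi A * pi x0 + pi B != 0 by rewrite -pc0 expf_neq0.
case: hc eca ecb => -> ; rewrite ?polyCN polyC1 ?mulN1r ?mul1r => eca ecb.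
  exact: (rigid_lifts A B B' x0 a b a' b').
(* For the sign -1, the pair (-a', -b') solves the same norm equation and has the right
   reduction. *)
apply: (rigid_lifts A B B' x0 a b (- a') (- b')) => //.
- by rewrite size_polyN.
- by rewrite rmorphN /= eca opprK.
- by rewrite rmorphN /= ecb opprK.
- by rewrite !sqrrN.
Qed.

End Rigidity.

(** * Counting points *)

Lemma leq_card_fibers (S T : finType) (f : S -> T) (X : {set S}) (Y : {set T}) (k : nat) :
    (forall x, x \in X -> f x \in Y) ->
    (forall y, y \in Y -> #|[set x in X | f x == y]| <= k)%N ->
  (#|X| <= k * #|Y|)%N.
Proof.
move=> fXY hk; rewrite -sum1_card (partition_big f (mem Y)) //=.
rewrite mulnC -sum_nat_const; apply: leq_sum => y hy.
apply: leq_trans (hk y hy); rewrite -sum1_card.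
by rewrite (eq_bigl (fun x => x \in [set x in X | f x == y])) // => x; rewrite inE.
Qed.

Section FieldCount.
Variables (F : finFieldType) (p : nat).
Hypothesis charFp : p \in [pchar F].
Hypothesis cardF : #|F| = p.
Hypothesis p_gt10 : (10 < p)%N.

Lemma frobenius_id (c : F) : c ^+ p = c.
Proof. by rewrite -cardF expf_card. Qed.

Lemma odd_char : odd p.
Proof.
have pp := pcharf_prime charFp.
by case: (even_prime pp) => // e; move: p_gt10; rewrite e.
Qed.

Lemma vanishing_poly (q : {poly F}) : (forall x, q.[x] = 0) -> 'X^p - 'X %| q.
Proof.
move=> hq; rewrite -cardF finField_genPoly; apply: uniq_roots_dvdp.
  by apply/allP => x _; apply/rootP.
by rewrite uniq_rootsE index_enum_uniq.
Qed.

Lemma size_XpX : size ('X^p - 'X : {poly F}) = p.+1.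
Proof.
by rewrite size_polyDl size_polyXn // size_polyN size_polyX ltnS (leq_trans _ p_gt10).
Qed.

(* Stepanov's argument: if every value of the cubic f is a square then f^((p+1)/2) agrees with f
   on F; the differential equation of f^((p+1)/2) then forces 2 f f'' = f'^2. *)
Lemma cubic_nonsquare_value (A B : F) : exists x, forall y, y ^+ 2 != x ^+ 3 + A * x + B.
Proof.
have p_gt3 : (3 < p)%N by apply: leq_trans p_gt10.
have three0 := three_neq0 F p charFp p_gt3.
set f := wpoly F A B; pose m := p.+1./2.
have em : (2 * m = p.+1)%N by rewrite /m; have := odd_char; clear; lia.
have [/existsP [x /forallP hx]|] := boolP [exists x, [forall y, y ^+ 2 != x ^+ 3 + A * x + B]].
  by exists x.
rewrite negb_exists => /forallP hsq.
have sq x : exists y, y ^+ 2 = f.[x].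
  have := hsq x; rewrite negb_forall => /existsP [y]; rewrite negbK => /eqP e.
  by exists y; rewrite horner_wpoly.
(* On a square, (y^2)^m = y^(p+1) = y^2, so f^m - f vanishes on all of F. *)
have [h eh] : exists h : {poly F}, f ^+ m - f = h * ('X^p - 'X).
  apply/dvdpP; apply: vanishing_poly => x; rewrite hornerD hornerN horner_exp.
  by have [y <-] := sq x; rewrite -exprM em exprS frobenius_id expr2 subrr.
have sf := size_wpolyF F A B; have mf := wpoly_monic F A B.
have sh : (2 * size h <= p + 5)%N.
  have [->|h0] := eqVneq h 0; first by rewrite size_poly0.
  have sW : size ('X^p - 'X : {poly F}) = p.+1.
    exact: size_XpX.
  have W0 : 'X^p - 'X != 0 :> {poly F} by rewrite -size_poly_gt0 sW.
  have := congr1 (fun q : {poly F} => size q) eh; rewrite /= size_mulF // sW.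
  have : (size (f ^+ m - f)%R <= 3 * m + 1)%N.
    apply: leq_trans (size_polyD _ _) _; rewrite size_polyN geq_max sf.
    rewrite (leq_trans (size_poly_exp_leq _ _)) ?sf; move: em p_gt10; clear; lia.
  by move: em; rewrite !degpE; clear; lia.
set W := 'X^p - 'X in eh.
have dW : W^`() = -1.
  by rewrite /W derivB derivXn derivX -scaler_nat (pcharf0 charFp) scale0r add0r.
have dDM (u v w : {poly F}) : (u + v * w)^`() = u^`() + (v^`() * w + v * w^`()).
  by rewrite derivD derivM.
(* Substitutes f^m = f + h W in 2 f (f^m)' = (p+1) f' f^m = f' f^m, with W' = -1. *)
have e1 : W * (2 * f * h^`() - f^`() * h) = 2 * f * h - f * f^`().
  have efm : f ^+ m = f + h * W by rewrite -eh addrC subrK.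
  have := congr1 (@deriv F) efm; rewrite deriv_exp dDM dW => /(congr1 (fun q => 2 * f * q)).
  have -> : 2 * f * (f^`() * f ^+ m.-1 *+ m) = (f^`() * f ^+ m) * (2 * m)%:R.
    have m_gt0 : (0 < m)%N by move: em p_gt10; clear; lia.
    have -> : f ^+ m = f * f ^+ m.-1 by rewrite -exprS prednK.
    by rewrite natrM -mulr_natl; ring.
  rewrite em -addn1 natrD -polyC_natr (pcharf0 charFp) add0r mulr1 efm => e.
  apply: (@eq_from_sub _ _ _ (2 * f * (f^`() + (h^`() * W + h * -1)) - f^`() * (f + h * W))).
    by ring.
  by rewrite -e subrr.
(* The left side of [e1] is a multiple of W, of degree p, and the right side is too small to be a
   nonzero one. With size h at most (p+5)/2 this comparison needs p > 9, whence the threshold on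
   p. *)
have e2 : 2 * f * h - f * f^`() = 0.
  apply/eqP; apply: contraTT isT => r0.
  have q0 : 2 * f * h^`() - f^`() * h != 0 by apply: contraNneq r0 => q0; rewrite -e1 q0 mulr0.
  have W0 : W != 0 by apply: contraNneq r0 => W0; rewrite -e1 W0 mul0r.
  have sW : size W = p.+1.
    exact: size_XpX.
  have := congr1 (fun q : {poly F} => size q) e1; rewrite /= size_mulF // sW.
  have : (0 < size (2 * f * h^`() - f^`() * h)%R)%N by rewrite size_poly_gt0.
  have : (size (2 * f * h - f * f^`())%R <= (maxn (3 + size h) 6))%N.
    have -> : 2 * f * h - f * f^`() = 2 *: (f * h) - f * f^`() by rewrite -mul_polyC; ring.
    have h1 : (size (2 *: (f * h))%R <= 3 + size h)%N.
      apply: leq_trans (size_scale_leq _ _) _; apply: leq_trans (size_polyMleq _ _) _.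
      by rewrite sf.
    have h2 : (size (f * f^`())%R <= 6)%N.
      apply: leq_trans (size_polyMleq _ _) _; rewrite sf.
      by have := lt_size_deriv (monic_neq0 mf); rewrite sf !degpE; clear; lia.
    apply: leq_trans (size_polyD _ _) _.
    by rewrite size_polyN geq_max !leq_max h1 h2 orbT.
  by move: sh p_gt10; rewrite !degpE; clear; lia.
have f0 : f != 0 by apply: monic_neq0.
have e3 : 2 * h = f^`().
  by apply/subr0_eq; apply: (mulfI f0); rewrite mulr0 -e2; ring.
have e4 : 2 * f * h^`() - f^`() * h = 0.
  have W0 : W != 0 by apply: contra_eqN dW => /eqP ->; rewrite deriv0 eq_sym oppr_eq0 oner_eq0.
  by apply: (mulfI W0); rewrite e1 e2 mulr0.
have e5 : 2 * f * f^`()^`() = f^`() * f^`().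
  have eh' : 2 * h^`() = f^`()^`().
    by rewrite -e3 derivM (_ : (2 : {poly F}) = 2%:P) ?derivC ?mul0r ?add0r // polyC_natr.
  apply: (@eq_from_sub _ _ _ (2 * (2 * f * h^`() - f^`() * h))); last by rewrite e4 mulr0.
  have -> : f^`() * f^`() = f^`() * (2 * h) by rewrite e3.
  by rewrite -eh'; ring.
(* This is 2 f f'' - f'^2, with leading coefficient 12 - 9 = 3. *)
have : 3%:P * 'X^4 + (6 * A)%:P * 'X^2 + (12 * B)%:P * 'X - (A ^+ 2)%:P = 0 :> {poly F}.
  have d2 : f^`()^`() = 6%:P * 'X.
    rewrite (deriv_wpoly F A B) !(derivD, derivM, derivC, derivX, expr2); ring.
  rewrite d2 (deriv_wpoly F A B) in e5.
  apply: (@eq_from_sub _ _ _ (2 * f * (6%:P * 'X) - (3%:P * 'X^2 + A%:P) * (3%:P * 'X^2 + A%:P))).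
    by rewrite /f /wpoly; ring.
  by rewrite e5 subrr.
move/(congr1 (fun q : {poly F} => q`_4)).
rewrite !(coefD, coefN, coefCM, coefXn, coefX, coefC) /= !(mulr0, mulr1, addr0, oppr0) => /eqP.
by rewrite (negPf three0).
Qed.

Lemma card_roots_sq (c : F) : (#|[set y : F | (y ^+ 2 == c)%R]| <= 2)%N.
Proof.
have [->|[y0]] := set_0Vmem [set y : F | (y ^+ 2 == c)%R]; first by rewrite cards0.
rewrite inE => /eqP <-.
have h2 : (#|[set y0; (- y0)%R]| <= 2)%N by rewrite cards2; case: (_ != _).
apply: leq_trans h2; apply: subset_leq_card; apply/subsetP => y.
by rewrite !inE eqf_sqr.
Qed.

(** One abscissa without points is enough: it brings the bound 2p(p-1) + p for all points over Z/p^2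
    below 2 p^2. *)
Lemma card_affine (A B : F) :
  (#|[set w : F * F | (w.2 ^+ 2 == w.1 ^+ 3 + A * w.1 + B)%R]| <= 2 * p.-1)%N.
Proof.
have [x0 hx0] := cubic_nonsquare_value A B.
apply: leq_trans (@leq_card_fibers _ _ fst _ [set~ x0] 2 _ _) _.
- move=> [x y]; rewrite !inE /= => /eqP e; apply/eqP => ex.
  by have := hx0 y; rewrite -ex e eqxx.
- move=> x _; apply: leq_trans (card_roots_sq (x ^+ 3 + A * x + B)).
  apply: leq_trans (leq_imset_card (fun y => (x, y)) _).
  apply: subset_leq_card; apply/subsetP => -[x' y]; rewrite !inE /= => /andP [/eqP e /eqP ex].
  by apply/imsetP; exists y; rewrite ?inE ?ex // -ex e.
- by rewrite cardsC1 cardF.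
Qed.

Lemma card_two_torsion (A B : F) :
  (#|[set w : F * F | ((w.2 == 0) && (w.1 ^+ 3 + A * w.1 + B == 0))%R]| <= 3)%N.
Proof.
set S := [set w | _]; have f0 : wpoly F A B != 0 by rewrite monic_neq0 ?wpoly_monic.
have := @max_poly_roots _ _ [seq w.1 | w <- enum S] f0.
rewrite (size_wpolyF F) size_map -cardE ltnS; apply.
  apply/allP => x /mapP [w]; rewrite mem_enum inE => /andP [_ /eqP e] ->.
  by rewrite /root horner_wpoly e.
rewrite map_inj_in_uniq ?enum_uniq // => -[x y] [x' y']; rewrite !mem_enum !inE /=.
by move=> /andP [/eqP -> _] /andP [/eqP -> _] ->.
Qed.

End FieldCount.

(** * Points over Z/p^2 above the points over F_p *)

Section LocalCount.
Variables (R : finComUnitRingType) (F : finFieldType) (pi : {rmorphism R -> F}).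
Hypothesis unitE : forall x, (x \is a GRing.unit) = (pi x != 0).
Variables (e : R) (g : R -> R).
Hypothesis e_sq : e * e = 0.
Hypothesis kerE : forall x, pi x = 0 -> x = e * g x.
Variable p : nat.
Hypothesis charFp : p \in [pchar F].
Hypothesis cardF : #|F| = p.
Hypothesis p_gt10 : (10 < p)%N.

Lemma ker_mul x y : pi x = 0 -> pi y = 0 -> x * y = 0.
Proof.
move=> /kerE -> /kerE ->.
by rewrite mulrACA e_sq mul0r.
Qed.

Lemma card_ker : (#|[set x : R | pi x == 0%R]| <= p)%N.
Proof.
rewrite -cardF -cardsT.
have inj : {in [set x : R | pi x == 0] &, injective (fun x => pi (g x))}.
  move=> x x'; rewrite !inE => /eqP hx /eqP hx' eg.
  apply/subr0_eq; rewrite (kerE x hx) (kerE x' hx') -mulrBr.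
  by rewrite (kerE (g x - g x')) ?rmorphB ?eg ?subrr // mulrA e_sq mul0r.
by rewrite -(card_in_imset inj) subset_leq_card ?subsetT.
Qed.

Lemma card_fiber (x0 : R) : (#|[set x : R | pi x == pi x0]| <= p)%N.
Proof.
apply: leq_trans card_ker.
have inj : injective (fun x : R => x - x0) by move=> x x' /addIr.
rewrite -(card_imset _ inj); apply: subset_leq_card; apply/subsetP => z.
by case/imsetP => x; rewrite !inE => /eqP ex ->; rewrite rmorphB ex subrr.
Qed.

Definition on_affine (K : comUnitRingType) (A B : K) (w : K * K) :=
  w.2 ^+ 2 == w.1 ^+ 3 + A * w.1 + B.

Definition pi2 (w : R * R) := (pi w.1, pi w.2).

Variables A B : R.
Hypothesis disc_neq0 : 4 * pi A ^+ 3 + 27 * pi B ^+ 2 != 0.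

Lemma on_affine_pi w : on_affine _ A B w -> on_affine _ (pi A) (pi B) (pi2 w).
Proof.
by move=> /eqP e0; apply/eqP; rewrite /= -rmorphXn e0; ring.
Qed.

(* The curve is smooth, so x, or y when y vanishes mod p, is a coordinate on each residue disc. *)
Lemma card_affine_fiber (z : F * F) :
  (#|[set w in [set w : R * R | on_affine _ A B w] | pi2 w == z]| <= p)%N.
Proof.
set S := [set w in _ | _].
have [->|[[x0 y0]]] := set_0Vmem S; first by rewrite cards0.
rewrite !inE /= => /andP [/eqP /= c0 /eqP ez].
have two0 : (2 : F) != 0 by apply: (two_neq0 F p) => //; apply: leq_trans p_gt10.
have hS w : w \in S -> [/\ w.2 ^+ 2 = w.1 ^+ 3 + A * w.1 + B, pi w.1 = pi x0 & pi w.2 = pi y0].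
  by rewrite !inE -ez => /andP [/eqP c /eqP [-> ->]].
have [y00|y00] := eqVneq (pi y0) 0.
  have inj : {in S &, injective snd}.
    move=> [x y] [x' y'] /hS [/= c1 ex1 ey1] /hS [/= c2 ex2 ey2] eyy.
    rewrite eyy in c1 *; congr (_, _); apply/subr0_eq.
    (* Modulo p this is f'(x0); were it zero, x0 would be a double root of f and the discriminant
       would vanish. *)
    have hu : x ^+ 2 + x * x' + x' ^+ 2 + A \is a GRing.unit.
      rewrite unitE (_ : pi _ = pi x ^+ 2 + pi x * pi x' + pi x' ^+ 2 + pi A); last by ring.
      rewrite ex1 ex2; apply: contraNneq disc_neq0 => h.
      have ha : pi A = - (3 * pi x0 ^+ 2).
        by apply/eqP; rewrite -subr_eq0 opprK -h; apply/eqP; ring.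
      have hb : pi B = - (pi x0 ^+ 3 + pi A * pi x0).
        apply/eqP; rewrite -subr_eq0 opprK; apply/eqP.
        transitivity (pi y0 ^+ 2); last by rewrite y00 expr0n.
        by rewrite -(rmorphXn pi 2 y0) c0; ring.
      by apply/eqP; rewrite hb ha; ring.
    apply: (mulIr hu); rewrite mul0r.
    apply: (@eq_from_sub _ _ _ ((x ^+ 3 + A * x + B) - (x' ^+ 3 + A * x' + B))).
      by ring.
    by rewrite -c1 -c2 subrr.
  rewrite -(card_in_imset inj); apply: leq_trans (card_fiber y0).
  apply: subset_leq_card; apply/subsetP => z'.
  by case/imsetP => w /hS [_ _ ew] ->; rewrite inE ew.
have inj : {in S &, injective fst}.
  move=> [x y] [x' y'] /hS [/= c1 ex1 ey1] /hS [/= c2 ex2 ey2] exx.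
  rewrite exx in c1 *; congr (_, _); apply/subr0_eq.
  have hu : y + y' \is a GRing.unit.
    rewrite unitE rmorphD ey1 ey2 (_ : _ + _ = 2 * pi y0) ?mulf_neq0 //; ring.
  by apply: (mulIr hu); rewrite mul0r -subr_sqr c1 c2 subrr.
rewrite -(card_in_imset inj); apply: leq_trans (card_fiber x0).
apply: subset_leq_card; apply/subsetP => z'.
by case/imsetP => w /hS [_ ew _] ->; rewrite inE ew.
Qed.

Lemma card_affine_lift : (#|[set w : R * R | on_affine _ A B w]| <= p * (2 * p.-1))%N.
Proof.
apply: leq_trans (leq_mul (leqnn p) (card_affine F p charFp cardF p_gt10 (pi A) (pi B))).
apply: (@leq_card_fibers _ _ pi2) => [w|z _]; last exact: card_affine_fiber.
by rewrite !inE => /on_affine_pi.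
Qed.

Lemma card_affine_lift_nonunit : (forall w, on_affine _ A B w -> w.2 \isn't a GRing.unit) ->
  (#|[set w : R * R | on_affine _ A B w]| <= p * 3)%N.
Proof.
move=> h; apply: leq_trans (leq_mul (leqnn p) (card_two_torsion F (pi A) (pi B))).
apply: (@leq_card_fibers _ _ pi2) => [w|z _]; last exact: card_affine_fiber.
rewrite !inE => hw; have /eqP hw' := on_affine_pi _ hw.
have := h w hw; rewrite unitE negbK => /eqP hy.
by rewrite /= hy eqxx -hw' /= hy expr0n.
Qed.

(** If z is not a unit, the equation puts x in the kernel of pi, so y is a unit; then x^3 and z^2
    vanish and y^2 z = 0 forces z = 0. Only the points (t : 1 : 0) lie above O. *)
Lemma on_curve_normal_form (v : R * R * R) : on_curve A B v ->
  (exists2 w : R * R, on_affine _ A B w & proportional _ (w.1, w.2, 1) v) \/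
  (exists2 t : R, pi t = 0 & proportional _ (t, 1, 0) v).
Proof.
case: v => [[x y] z] /= /andP [um /eqP c].
have [uz|nz] := boolP (z \is a GRing.unit).
  left; exists (x / z, y / z); last first.
    by exists z; rewrite // /scale3 mulr1 ![z * _]mulrC !divrK.
  have uz3 : z ^+ 3 \is a GRing.unit by rewrite unitrX.
  apply/eqP; apply: (mulIr uz3).
  have ey : y = y / z * z by rewrite divrK.
  have ex : x = x / z * z by rewrite divrK.
  move: c; rewrite {1}ex {1}ey [X in _ + _ * X * _]ex /= => c.
  set X := x / z in c *; set Y := y / z in c *.
  transitivity ((Y * z) ^+ 2 * z); first by ring.
  by rewrite c; ring.
right; have piz : pi z = 0 by apply/eqP; rewrite -[_ == _]negbK -unitE.
have pix : pi x = 0.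
  have : pi y ^+ 2 * pi z = pi x ^+ 3 + pi A * pi x * pi z ^+ 2 + pi B * pi z ^+ 3.
    by rewrite -rmorphXn -rmorphM c; ring.
  by rewrite piz !expr0n /= !mulr0 !addr0 => /esym /eqP; rewrite expf_eq0 => /andP [_ /eqP].
have uy : y \is a GRing.unit.
  by move: um; rewrite !unitE pix piz eqxx /= orbF.
have z0 : z = 0.
  have uy2 : y ^+ 2 \is a GRing.unit by rewrite unitrX.
  apply: (mulrI uy2).
  rewrite mulr0 c; transitivity (x * x * x + A * x * (z * z) + B * z * (z * z)); first by ring.
  by rewrite (ker_mul x x) // (ker_mul z z) // mul0r !mulr0 !addr0.
exists (x / y); first by rewrite rmorphM pix mul0r.
by exists y; rewrite // /scale3 mulr1 mulr0 z0 mulrC divrK.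
Qed.

End LocalCount.

(** * The set frakA *)

Lemma card_set_split (T : finType) (X : {set T}) (P : pred T) :
  #|X| = (#|[set x in X | P x]| + #|[set x in X | ~~ P x]|)%N.
Proof.
rewrite -(cardsID [set x | P x] X).
by congr (_ + _)%N; apply: eq_card => x; rewrite !inE // andbC.
Qed.

Lemma unique_class_arith (p E N q : nat) : (p ^ 2 * q <= E)%N -> (E <= N + p)%N ->
  (N <= p * (2 * p.-1))%N -> (0 < q)%N -> (10 < p)%N -> q = 1%N.
Proof. by rewrite -mulnn => *; nia. Qed.

Lemma two_torsion_arith (p E N q : nat) : (p ^ 2 * q <= E)%N -> (E <= N + p)%N ->
  (N <= p * 3)%N -> (0 < q)%N -> (10 < p)%N -> False.
Proof. by rewrite -mulnn => *; nia. Qed.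

(** * Reduction from Z/p^2 to F_p and the bound on frakA *)

Section Reduction.
Variable p : nat.
Hypothesis p_prime : prime p.
Local Notation R := 'Z_(p ^ 2).
Local Notation F := 'F_p.

Lemma p2_gt1 : (1 < p ^ 2)%N.
Proof. by have := prime_gt1 p_prime; rewrite -mulnn; clear; nia. Qed.

Lemma Fp_nat_mod2 m : (m %% p ^ 2)%:R = m%:R :> F.
Proof.
by rewrite -(Fp_nat_mod p_prime (m %% p ^ 2)) modn_dvdm ?dvdn_exp // Fp_nat_mod.
Qed.

(** The primality proof is an argument so that the morphism instances, which depend on it, can be
    attached to the term [redp p_prime]. *)
Definition redp (_ : prime p) (x : R) : F := (x : nat)%:R.

Lemma redp_is_nmod_morphism : nmod_morphism (redp p_prime).
Proof.
split=> [|x y]; first by rewrite /redp.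
rewrite /redp /=.
rewrite -natrD -[RHS]Fp_nat_mod2; congr (_ %% _)%:R; exact: Zp_cast p2_gt1.
Qed.

Lemma redp_is_monoid_morphism : monoid_morphism (redp p_prime).
Proof.
split=> [|x y]; rewrite /redp /=.
  by rewrite -[RHS](Fp_nat_mod2 1%N); congr (_ %% _)%:R; exact: Zp_cast p2_gt1.
rewrite -natrM -[RHS]Fp_nat_mod2; congr (_ %% _)%:R; exact: Zp_cast p2_gt1.
Qed.

HB.instance Definition _ := GRing.isNmodMorphism.Build R F (redp p_prime) redp_is_nmod_morphism.
HB.instance Definition _ := GRing.isMonoidMorphism.Build R F (redp p_prime) redp_is_monoid_morphism.

Definition reduction : {rmorphism R -> F} := redp p_prime.

Lemma reductionE x : reduction x = (x : nat)%:R.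
Proof. by []. Qed.

Lemma reduction_eq0 x : (reduction x == 0) = (p %| x)%N.
Proof. by rewrite reductionE (dvdn_pcharf (pchar_Fp p_prime)). Qed.

Lemma reduction_unit x : (x \is a GRing.unit) = (reduction x != 0).
Proof.
rewrite reduction_eq0 -[x in LHS]natr_Zp unitZpE ?p2_gt1 //.
by rewrite coprime_pexpl // prime_coprime.
Qed.

Lemma Zp2_eq0 m : ((m%:R : R) == 0) = (p ^ 2 %| m)%N.
Proof.
apply/eqP/idP => [|/dvdnP [k ->]].
  move/(congr1 val); rewrite /= val_Zp_nat ?p2_gt1 // => /eqP.
  by [].
by rewrite natrM pchar_Zp ?p2_gt1 // mulr0.
Qed.

Lemma p_sq0 : p%:R * p%:R = 0 :> R.
Proof. by rewrite -natrM mulnn; apply/eqP; rewrite Zp2_eq0. Qed.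

Lemma reduction_ker x : reduction x = 0 -> x = p%:R * (x %/ p)%:R.
Proof.
move/eqP; rewrite reduction_eq0 => h.
by rewrite -natrM mulnC divnK // natr_Zp.
Qed.

Lemma reduction_ann x : p%:R * x = 0 -> reduction x = 0.
Proof.
rewrite -[x in X in X -> _]natr_Zp -natrM => /eqP; rewrite Zp2_eq0 => h.
apply/eqP; rewrite reduction_eq0; move: (nat_of_ord x) h => n.
by rewrite -mulnn dvdn_pmul2l ?prime_gt0.
Qed.

Lemma card_Zp2 : #|R| = (p ^ 2)%N.
Proof. by rewrite card_ord Zp_cast ?p2_gt1. Qed.

Lemma card_frakA_trivial : (#|frakA p| <= p ^ 4)%N.
Proof.
apply: leq_trans (max_card _) _.
by rewrite card_prod !card_Zp2 -expnD.
Qed.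

Lemma disc_reduction (A B : R) : ~~ (p %| nat_of_ord (disc A B))%N ->
  4 * reduction A ^+ 3 + 27 * reduction B ^+ 2 != 0.
Proof.
rewrite -reduction_eq0; apply: contraNneq => h.
have -> : reduction (disc A B) = - 16 * (4 * reduction A ^+ 3 + 27 * reduction B ^+ 2).
  by rewrite /disc; ring.
by rewrite h mulr0.
Qed.

Hypothesis p_gt10 : (10 < p)%N.
Let charFp := pchar_Fp p_prime.
Let cardF := card_Fp p_prime.

Lemma proj_class_eq (v w : R * R * R) : proportional _ v w -> proj_class v = proj_class w.
Proof.
move=> h; have h' := proportional_sym _ _ _ h.
have sub a b : proportional R a b -> proj_class b \subset proj_class a.
  move=> [u hu ->]; apply/subsetP => t; rewrite !inE => /existsP [u' /andP [hu' /eqP ->]].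
  by apply/existsP; exists (u' * u); rewrite unitrMl // hu' scale3A eqxx.
by apply/eqP; rewrite eqEsubset !sub.
Qed.

Lemma mem_proj_class (v : R * R * R) : v \in proj_class v.
Proof. by rewrite inE; apply/existsP; exists 1; rewrite unitr1 scale3_1 eqxx. Qed.

Section Curve.
Variables A B : R.
Hypothesis discE : ~~ (p %| nat_of_ord (disc A B))%N.
Let disc0 := disc_reduction A B discE.

Lemma card_E_pts : (#|E_pts A B| <= #|[set w : R * R | on_affine _ A B w]| + p)%N.
Proof.
have h : E_pts A B \subset
    [set proj_class (w.1, w.2, 1) | w in [set w : R * R | on_affine _ A B w]]
    :|: [set proj_class (t, 1, 0) | t in [set t : R | reduction t == 0]].
  apply/subsetP => c /imsetP [v hv ->]; rewrite inE; apply/orP.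
  have := on_curve_normal_form _ _ _ reduction_unit _ _ p_sq0 reduction_ker A B v hv.
  case=> [[w hw hp]|[t ht hp]]; [left|right].
    by rewrite -(proj_class_eq _ _ hp); apply/imsetP; exists w; rewrite ?inE.
  by rewrite -(proj_class_eq _ _ hp); apply/imsetP; exists t; rewrite ?inE ?ht.
apply: leq_trans (subset_leq_card h) _; apply: leq_trans (leq_card_setU _ _) _.
apply: leq_add; apply: leq_trans (leq_imset_card _ _) _ => //.
exact: card_ker _ _ _ _ _ p_sq0 reduction_ker _ cardF.
Qed.

Lemma on_curve_O : on_curve A B (pt_O R).
Proof. by rewrite /on_curve /pt_O /unimod unitr1 orbT /= !(expr0n, mulr0, addr0) /=. Qed.

(** [pE_pts] contains the class of O, so once it is known to be a singleton every pP is O. A point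
    with unit y exists because otherwise all affine points would lie above the at most three roots
    of f mod p, too few for p^2 classes. *)
Lemma dim2_torsion : dim_tensor_Fp A B = 2%N ->
  (exists2 w, on_affine R A B w & w.2 \is a GRing.unit) /\
  (forall w, on_affine R A B w -> proportional _ (pt_O R) (mulT A B p (w.1, w.2, 1))).
Proof.
rewrite /dim_tensor_Fp; set E := #|E_pts A B|; set q := #|pE_pts A B| => hdim.
have p_gt0 : (0 < p)%N by apply: leq_trans p_gt10.
have mO : proj_class (mulT A B p (pt_O R)) \in pE_pts A B.
  by apply: imset_f; exact: on_curve_O.
have q_gt0 : (0 < q)%N by apply/card_gt0P; exists (proj_class (mulT A B p (pt_O R))).
(* The quotient in [dim_tensor_Fp] is a floor; it is positive, since [logn] of 0 is 0, and divisible
   by p^2, which still yields p^2 q <= E. *)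
have hE : (p ^ 2 * q <= E)%N.
  have d_gt0 : (0 < E %/ q)%N by case: (E %/ q)%N hdim => //; rewrite logn0.
  have : (p ^ 2 %| E %/ q)%N by rewrite pfactor_dvdn // hdim.
  by move/dvdn_leq => /(_ d_gt0) h; rewrite -leq_divRL.
have hu := card_E_pts; rewrite -/E in hu.
have q1 : q = 1%N.
  have hN := card_affine_lift _ _ _ reduction_unit _ _ p_sq0 reduction_ker _ charFp cardF p_gt10 A B disc0.
  exact: unique_class_arith hE hu hN q_gt0 p_gt10.
split.
  have [/existsP [w /andP [h1 h2]]|] := boolP [exists w, on_affine R A B w && (w.2 \is a GRing.unit)].
    by exists w.
  rewrite negb_exists => /forallP h.
  have h' w : on_affine R A B w -> w.2 \isn't a GRing.unit by have := h w; case: (on_affine R A B w).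
  have hN := card_affine_lift_nonunit _ _ _ reduction_unit _ _ p_sq0 reduction_ker _ charFp cardF p_gt10 A B disc0 h'.
  by have := two_torsion_arith _ _ _ _ hE hu hN q_gt0 p_gt10.
move=> w hw; have /eqP/cards1P [c hc] := q1.
have hwE : on_curve A B (w.1, w.2, 1).
  by rewrite /on_curve /unimod unitr1 !orbT /= !expr1n !mulr1.
have mw : proj_class (mulT A B p (w.1, w.2, 1)) \in pE_pts A B by apply: imset_f.
move: mO mw; rewrite hc => /set1P e1 /set1P e2.
have := mem_proj_class (mulT A B p (w.1, w.2, 1)).
rewrite e2 -e1 mulT_O inE => /existsP [u /andP [hu' /eqP ->]].
by exists u.
Qed.

End Curve.

Lemma frakA_fiber (A B B' : R) : (A, B) \in frakA p -> (A, B') \in frakA p ->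
  reduction A != 0 -> reduction B = reduction B' -> B = B'.
Proof.
rewrite !inE /= => /andP [d /eqP hd] /andP [d' /eqP hd'] A0 eB.
have [[[x y] /eqP /= c uy] tors] := dim2_torsion A B d hd.
have [_ tors'] := dim2_torsion A B' d' hd'.
have u2 : (2 : R) \is a GRing.unit.
  rewrite reduction_unit rmorph_nat; apply: (two_neq0 _ _ charFp); exact: leq_trans p_gt10.
have u2y : 2 * y \is a GRing.unit by rewrite unitrMl.
have k0 : reduction (B' - B) = 0 by apply/eqP; rewrite rmorphB subr_eq0; apply/eqP; exact: esym eB.
(* One Newton step from y, exact because (B' - B)^2 = 0; the abscissa x is kept, as [torsion_rigid]
   requires. *)
pose y' := y + (B' - B) / (2 * y).
have c' : y' ^+ 2 = x ^+ 3 + A * x + B'.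
  have h : (B' - B) / (2 * y) * (2 * y) = B' - B by rewrite divrK.
  have h2 : ((B' - B) / (2 * y)) ^+ 2 = 0.
    by rewrite expr2 (ker_mul _ _ _ _ _ p_sq0 reduction_ker) // rmorphM k0 mul0r.
  apply: (@eq_from_sub _ _ _ ((y ^+ 2 - (x ^+ 3 + A * x + B)) + ((B' - B) / (2 * y)) ^+ 2
     + ((B' - B) / (2 * y) * (2 * y) - (B' - B)))).
    by rewrite /y'; set t := (B' - B) / _; ring.
  by rewrite h h2 c !subrr !addr0.
have frob : forall c : F, c ^+ p = c by apply: frobenius_id.
apply: (torsion_rigid _ _ _ reduction_unit _ _ p_sq0 reduction_ker reduction_ann _ charFp
  (leq_trans (isT : 3 < 11)%N p_gt10) frob A B B' x y y') => //.
- by rewrite rmorphD rmorphM k0 mul0r addr0.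
- by apply: (tors (x, y)); apply/eqP.
- by apply: (tors' (x, y')); apply/eqP.
Qed.

Lemma card_frakA_large : (#|frakA p| <= 2 * p ^ 3)%N.
Proof.
pose S0 := [set AB in frakA p | reduction AB.1 == 0].
pose S1 := [set AB in frakA p | reduction AB.1 != 0].
rewrite (card_set_split _ (frakA p) (fun AB => reduction AB.1 == 0)) -/S0 -/S1.
have h0 : (#|S0| <= p * p ^ 2)%N.
  have hs : S0 \subset setX [set x : R | reduction x == 0] [set: R].
    by apply/subsetP => -[A B]; rewrite !inE => /andP [_ ->].
  apply: leq_trans (subset_leq_card hs) _; rewrite cardsX cardsT card_Zp2 leq_mul //.
  exact: card_ker _ _ _ _ _ p_sq0 reduction_ker _ cardF.
have h1 : (#|S1| <= p ^ 2 * p)%N.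
  have inj : {in S1 &, injective (fun AB : R * R => (AB.1, reduction AB.2))}.
    move=> [A B] [A' B'] h h' /= [eA eB]; rewrite -eA in h' *.
    case/setIdP: h => h A0; case/setIdP: h' => h' _.
    by rewrite (frakA_fiber A B B' h h' A0 eB).
  rewrite -(card_in_imset inj); apply: leq_trans (max_card _) _.
  by rewrite card_prod card_Zp2 cardF.
by move: h0 h1; rewrite -!expnS -!expnSr; clear; lia.
Qed.

End Reduction.

Lemma card_frakA p : prime p -> (#|frakA p| <= 11 * p ^ 3)%N.
Proof.
move=> pp; have [p10|p11] := ltnP 10 p.
  by apply: leq_trans (card_frakA_large p pp p10) _; rewrite leq_mul2r orbT.
(* The constant 11 comes from here: for p < 11 the trivial p^4 is at most 11 p^3. *)
apply: leq_trans (card_frakA_trivial p pp) _.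
by rewrite expnS leq_mul2r ltnW ?orbT // ltnS.
Qed.

(** * Averages of periodic functions *)

Section PeriodicSums.
Variable R : realFieldType.

Lemma periodic_modn (m : nat) (h : nat -> R) : (forall i, h (i + m)%N = h i) ->
  forall i, h i = h (i %% m)%N.
Proof.
move=> hp i; rewrite [in LHS](divn_eq i m) addnC.
by elim: (i %/ m)%N => [|k ih]; rewrite ?mul0n ?addn0 // mulSn addnCA addnC hp.
Qed.

Lemma window_sum (m : nat) (h : nat -> R) : (forall i, h (i + m)%N = h i) ->
  forall s, \sum_(0 <= i < m) h (s + i)%N = \sum_(0 <= i < m) h i.
Proof.
move=> hp; elim=> [|s ih]; first by [].
rewrite -ih; apply: (addrI (h s)).
transitivity (\sum_(0 <= i < m.+1) h (s + i)%N).
  rewrite big_nat_recl // addn0; congr (_ + _).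
  by apply: eq_bigr => i _; rewrite addSnnS.
by rewrite big_nat_recr //= hp addrC.
Qed.

Lemma window_sum_mul (m : nat) (h : nat -> R) q s : (forall i, h (i + m)%N = h i) ->
  \sum_(0 <= i < q * m) h (s + i)%N = q%:R * \sum_(0 <= i < m) h i.
Proof.
move=> hp; elim: q => [|q ih]; first by rewrite mul0n big_geq // mul0r.
have -> : (q.+1 * m = q * m + m)%N by rewrite mulSn addnC.
rewrite (@big_cat_nat _ _ _ (q * m)%N) ?leq_addr //= ih.
have -> : \sum_(q * m <= i < q * m + m) h (s + i)%N = \sum_(0 <= i < m) h i.
  rewrite -{1}[(q * m)%N]add0n big_addn addKn -(window_sum _ _ hp (s + q * m)).
  by apply: eq_bigr => i _; rewrite addnAC addnA.
by rewrite -natr1 mulrDl mul1r.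
Qed.

Lemma window_sum_bounds (m : nat) (h : nat -> R) L s :
    (0 < m)%N -> (forall i, 0 <= h i) -> (forall i, h (i + m)%N = h i) ->
  (L %/ m)%:R * (\sum_(0 <= i < m) h i) <= \sum_(0 <= i < L) h (s + i)%N
    <= (L %/ m).+1%:R * (\sum_(0 <= i < m) h i).
Proof.
move=> m0 h0 hp; rewrite -!(window_sum_mul _ _ _ s) //.
have sub a b : (a <= b)%N -> \sum_(0 <= i < a) h (s + i)%N <= \sum_(0 <= i < b) h (s + i)%N.
  by move=> ab; rewrite (big_cat_nat _ ab) //= lerDl sumr_ge0.
by rewrite !sub ?leq_divM // ltnW // ltn_ceil.
Qed.

Lemma int_periodic_mul (m : nat) (f : int -> R) : (forall a, f (a + m%:Z) = f a) ->
  forall k a, f (a + (k * m)%:Z) = f a.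
Proof.
move=> hp; elim=> [|k ih] a; first by rewrite mul0n addr0.
by rewrite mulSn PoszD addrA [a + _]addrC -addrA [_ + (a + _)]addrC hp ih.
Qed.

Lemma sum_int_range (f : int -> R) M :
  \sum_(a <- int_range M) f a = \sum_(0 <= i < M.*2.+1) f (i%:Z - M%:Z).
Proof. by rewrite /int_range big_map /index_iota subn0. Qed.

Lemma int_range_sum_bounds (m : nat) (f : int -> R) M :
    (0 < m)%N -> (forall a, 0 <= f a) -> (forall a, f (a + m%:Z) = f a) ->
  (M.*2.+1 %/ m)%:R * (\sum_(0 <= i < m) f i%:Z) <= \sum_(a <- int_range M) f a
    <= (M.*2.+1 %/ m).+1%:R * (\sum_(0 <= i < m) f i%:Z).
Proof.
move=> m0 f0 hp; rewrite sum_int_range.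
(* Adding M m turns the possibly negative i - M into a natural number without changing f. *)
have e i : f (i%:Z - M%:Z) = f ((m.-1 * M + i)%N%:Z).
  rewrite -(int_periodic_mul m f hp M (i%:Z - M%:Z)); congr f.
  by case: m m0 {hp} => // m _; rewrite /= mulnS mulnC; lia.
have -> : \sum_(0 <= i < M.*2.+1) f (i%:Z - M%:Z) =
    \sum_(0 <= i < M.*2.+1) f ((m.-1 * M + i)%N%:Z) by apply: eq_bigr => i _.
apply: (window_sum_bounds m (fun i => f i%:Z)) => // i.
by rewrite PoszD hp.
Qed.

Lemma box_sum_bounds (m : nat) (f : int -> int -> R) M N :
    (0 < m)%N -> (forall a b, 0 <= f a b) ->
    (forall a b, f (a + m%:Z) b = f a b) -> (forall a b, f a (b + m%:Z) = f a b) ->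
  (M.*2.+1 %/ m)%:R * (N.*2.+1 %/ m)%:R * (\sum_(0 <= i < m) \sum_(0 <= j < m) f i%:Z j%:Z)
    <= \sum_(a <- int_range M) \sum_(b <- int_range N) f a b
    <= (M.*2.+1 %/ m).+1%:R * (N.*2.+1 %/ m).+1%:R *
       (\sum_(0 <= i < m) \sum_(0 <= j < m) f i%:Z j%:Z).
Proof.
move=> m0 f0 hp1 hp2.
have hI a := int_range_sum_bounds m (f a) N m0 (f0 a) (hp2 a).
pose g a := \sum_(b <- int_range N) f a b.
have g0 a : 0 <= g a by apply: sumr_ge0.
have gp a : g (a + m%:Z) = g a by apply: eq_bigr.
have /andP [l1 u1] := int_range_sum_bounds m g M m0 g0 gp.
apply/andP; split.
  apply: le_trans l1; rewrite -mulrA ler_wpM2l // mulr_sumr ler_sum // => i _.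
  by have /andP [] := hI i%:Z.
apply: le_trans u1 _; rewrite -mulrA ler_wpM2l // mulr_sumr ler_sum // => i _.
by have /andP [] := hI i%:Z.
Qed.

Lemma chinese_sum (m1 m2 : nat) (u v : nat -> R) : coprime m1 m2 -> (0 < m1)%N -> (0 < m2)%N ->
    (forall i, u (i + m1)%N = u i) -> (forall i, v (i + m2)%N = v i) ->
  \sum_(0 <= r < m1 * m2) u r * v r =
    (\sum_(0 <= i < m1) u i) * (\sum_(0 <= j < m2) v j).
Proof.
move=> cop m10 m20 hu hv; rewrite !big_mkord mulr_suml.
under [RHS]eq_bigr do rewrite mulr_sumr.
rewrite pair_big /=.
pose h (r : 'I_(m1 * m2)) : 'I_m1 * 'I_m2 :=
  (Ordinal (ltn_pmod r m10), Ordinal (ltn_pmod r m20)).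
have h_inj : injective h.
  move=> r r' [e1 e2]; apply/val_inj => /=.
  have : (r == r' %[mod m1 * m2])%N by rewrite chinese_remainder // e1 e2 !eqxx.
  by rewrite !modn_small // => /eqP.
rewrite [RHS](reindex h) /=.
  by apply: eq_bigr => r _; rewrite -!periodic_modn.
by apply: onW_bij; apply: inj_card_bij => //; rewrite card_prod !card_ord.
Qed.

Lemma chinese_sum2 (m1 m2 : nat) (u v : nat -> nat -> R) :
    coprime m1 m2 -> (0 < m1)%N -> (0 < m2)%N ->
    (forall i j, u (i + m1)%N j = u i j) -> (forall i j, u i (j + m1)%N = u i j) ->
    (forall i j, v (i + m2)%N j = v i j) -> (forall i j, v i (j + m2)%N = v i j) ->
  \sum_(0 <= r < m1 * m2) \sum_(0 <= s < m1 * m2) u r s * v r s =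
    (\sum_(0 <= i < m1) \sum_(0 <= j < m1) u i j) *
    (\sum_(0 <= i < m2) \sum_(0 <= j < m2) v i j).
Proof.
move=> cop m10 m20 hu1 hu2 hv1 hv2.
under eq_bigr => r _ do rewrite (chinese_sum m1 m2 (u r) (v r)) //.
by apply: chinese_sum => // i; apply: eq_bigr.
Qed.

End PeriodicSums.

(** * The second moment *)

Definition hit (p : nat) (a b : int) : bool :=
  ((a%:~R, b%:~R) : 'Z_(p ^ 2) * 'Z_(p ^ 2)) \in frakA p.

Lemma intr_Zp_periodic n (a : int) k : (1 < n)%N -> (n %| k)%N ->
  (a + k%:Z)%:~R = a%:~R :> 'Z_n.
Proof.
move=> n1 /dvdnP [d ->]; rewrite rmorphD /= -pmulrn natrM pchar_Zp //.
by rewrite mulr0 addr0.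
Qed.

Lemma hit_periodic p k a b : prime p -> (p ^ 2 %| k)%N ->
  (hit p (a + k%:Z) b = hit p a b) * (hit p a (b + k%:Z) = hit p a b).
Proof. by move=> pp pk; rewrite /hit !intr_Zp_periodic // p2_gt1. Qed.

(** Covariance of the hits at p and q, with L = Y^4, P2 = p^2, Q2 = q^2. The single sums enter with
    a negative sign, hence lower bounds for them. The main terms cancel, and by P2 + Q2 <= 2 m the
    rest is at most d d' m (3 (LM + LN) + m). Since L times each of LM, LN, m is at most LM LN, the
    total is 3 + 3 + 1 = 7. *)
Lemma offdiag_arith {R : realFieldType} {Spq Sq Sp d d' P2 Q2 m L LM LN : R} :
    m = P2 * Q2 -> 1 <= P2 -> 1 <= Q2 -> 0 <= d -> 0 <= d' ->
    0 <= LM -> 0 <= LN -> 0 <= L -> 0 <= m -> m <= L -> L <= LM -> L <= LN ->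
    Spq <= d * d' * ((LM + m) * (LN + m)) ->
    d * (LM * LN - P2 * (LM + LN)) <= Sp -> d' * (LM * LN - Q2 * (LM + LN)) <= Sq ->
  L * (Spq + - d * Sq + - d' * Sp + d * d' * (LM * LN)) <= 7 * d * d' * m * (LM * LN).
Proof.
move=> em p1 q1 dp dq M0 N0 L0 m0 mY hM hN hpq hp hq.
have mPQ : P2 + Q2 <= 2 * m by rewrite em; nra.
have h1 : Spq + - d * Sq + - d' * Sp + d * d' * (LM * LN) <=
   d * d' * (m * (LM + LN) + m ^+ 2 + (P2 + Q2) * (LM + LN)).
  have := ler_wpM2l dp hq; have := ler_wpM2l dq hp; move: hpq.
  by lra.
apply: le_trans (ler_wpM2l L0 h1) _.
rewrite (_ : 7 * d * d' * m * (LM * LN) = d * d' * (7 * m * (LM * LN))); last by ring.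
rewrite mulrCA ler_wpM2l ?mulr_ge0 //.
have h2 : m * (LM + LN) + m ^+ 2 + (P2 + Q2) * (LM + LN) <= m * (3 * (LM + LN) + m).
  have := ler_wpM2r (addr_ge0 M0 N0) mPQ; lra.
apply: le_trans (ler_wpM2l L0 h2) _.
rewrite (_ : 7 * m * (LM * LN) = m * (7 * (LM * LN))); last by ring.
rewrite mulrCA ler_wpM2l //.
have h3 : L * LM <= LN * LM by rewrite ler_wpM2r.
have h4 : L * LN <= LM * LN by rewrite ler_wpM2r.
have h5 : L * m <= LM * LN by rewrite ler_pM // (le_trans mY).
by move: h3 h4 h5; lra.
Qed.

Section Variance.
Variable R : realType.

Lemma sum_Zp n (f : 'Z_n -> R) : (1 < n)%N ->
  \sum_(0 <= i < n) f i%:R = \sum_(x : 'Z_n) f x.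
Proof.
move=> n1; have gen k : k = n -> \sum_(0 <= i < k) f i%:R = \sum_(0 <= i < n) f i%:R by move=> ->.
rewrite -(gen _ (Zp_cast n1)) big_mkord; apply: eq_bigr => x _.
by rewrite natr_Zp.
Qed.

Lemma sum_hit p : prime p ->
  \sum_(0 <= i < p ^ 2) \sum_(0 <= j < p ^ 2) (hit p i%:Z j%:Z)%:R = #|frakA p|%:R :> R.
Proof.
move=> pp; have n1 := p2_gt1 p pp.
transitivity (\sum_(x : 'Z_(p ^ 2)) \sum_(y : 'Z_(p ^ 2)) ((x, y) \in frakA p)%:R : R).
  rewrite -(sum_Zp _ (fun x => \sum_(y : 'Z_(p ^ 2)) ((x, y) \in frakA p)%:R)) //.
  by apply: eq_bigr => i _; rewrite -(sum_Zp _ (fun y => ((i%:R, y) \in frakA p)%:R)).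
rewrite pair_bigA /= -sum1_card natr_sum [RHS]big_mkcond /=.
by apply: eq_bigr => -[u v] _ /=; case: ifP.
Qed.

Definition density p : R := #|frakA p|%:R / p%:R ^+ 4.

Lemma density_ge0 p : 0 <= density p.
Proof. by rewrite divr_ge0 // exprn_ge0. Qed.

Lemma densityK p : prime p -> density p * p%:R ^+ 4 = #|frakA p|%:R.
Proof. by move=> /prime_gt0 p0; rewrite divfK // expf_neq0 // pnatr_eq0 -lt0n. Qed.

Lemma density_le1 p : prime p -> density p <= 1.
Proof.
move=> pp; rewrite ler_pdivrMr ?mul1r; last by rewrite exprn_gt0 // ltr0n prime_gt0.
by rewrite -natrX ler_nat card_frakA_trivial.
Qed.

Variables (Y : R) (M N : nat).
Let LM : R := M.*2.+1%:R.
Let LN : R := N.*2.+1%:R.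
Hypothesis Y_ge0 : 0 <= Y.
Hypothesis hM : Y ^+ 4 <= LM.
Hypothesis hN : Y ^+ 4 <= LN.

Definition box_sum (f : int -> int -> R) : R :=
  \sum_(a <- int_range M) \sum_(b <- int_range N) f a b.

Local Notation x p := (fun a b => (hit p a b)%:R).

Lemma box_sumD f g : box_sum (fun a b => f a b + g a b) = box_sum f + box_sum g.
Proof. by rewrite /box_sum -big_split; apply: eq_bigr => a _; rewrite big_split. Qed.

Lemma box_sumZ c f : box_sum (fun a b => c * f a b) = c * box_sum f.
Proof. by rewrite /box_sum mulr_sumr; apply: eq_bigr => a _; rewrite mulr_sumr. Qed.

Lemma box_sum_cst c : box_sum (fun _ _ => c) = c * (LM * LN).
Proof.
rewrite /box_sum !big_const_seq !count_predT /int_range !size_map !size_iota.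
by rewrite !iter_addr_0 -mulrnA -mulr_natr natrM mulrA mulrAC -mulrA.
Qed.

Lemma divn_bounds L m : (0 < m)%N ->
  (L %/ m)%:R * m%:R <= L%:R :> R /\ L%:R <= (L %/ m)%:R * m%:R + m%:R :> R.
Proof.
move=> m0; split; rewrite -natrM; first by rewrite ler_nat leq_divM.
by rewrite -natrD ler_nat addnC -mulSn ltnW // ltn_ceil.
Qed.

Lemma box_sum_upper m (f : int -> int -> R) T : (0 < m)%N -> (forall a b, 0 <= f a b) ->
    (forall a b, f (a + m%:Z) b = f a b) -> (forall a b, f a (b + m%:Z) = f a b) ->
    \sum_(0 <= i < m) \sum_(0 <= j < m) f i%:Z j%:Z = T * m%:R ^+ 2 ->
  box_sum f <= T * ((LM + m%:R) * (LN + m%:R)).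
Proof.
move=> m0 f0 p1 p2 hT.
have T0 : 0 <= T.
  rewrite -(pmulr_lge0 _ (_ : 0 < m%:R ^+ 2)) -?hT ?exprn_gt0 ?ltr0n //.
  by apply: sumr_ge0 => i _; apply: sumr_ge0.
have /andP [_] := box_sum_bounds R m f M N m0 f0 p1 p2; rewrite hT => h.
apply: le_trans h _.
have [hM' _] := divn_bounds M.*2.+1 m m0; have [hN' _] := divn_bounds N.*2.+1 m m0.
rewrite -/LM in hM'; rewrite -/LN in hN'.
rewrite (_ : _ * _ * (T * _) = T * (((M.*2.+1 %/ m).+1%:R * m%:R) * ((N.*2.+1 %/ m).+1%:R * m%:R))).
  rewrite ler_wpM2l // ler_pM ?mulr_ge0 // -natr1 mulrDl mul1r lerD2r //.
by ring.
Qed.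

Lemma box_sum_lower m (f : int -> int -> R) T : (0 < m)%N -> (forall a b, 0 <= f a b) ->
    (forall a b, f (a + m%:Z) b = f a b) -> (forall a b, f a (b + m%:Z) = f a b) ->
    \sum_(0 <= i < m) \sum_(0 <= j < m) f i%:Z j%:Z = T * m%:R ^+ 2 ->
    m%:R <= LM -> m%:R <= LN ->
  T * (LM * LN - m%:R * (LM + LN)) <= box_sum f.
Proof.
move=> m0 f0 p1 p2 hT mM mN.
have T0 : 0 <= T.
  rewrite -(pmulr_lge0 _ (_ : 0 < m%:R ^+ 2)) -?hT ?exprn_gt0 ?ltr0n //.
  by apply: sumr_ge0 => i _; apply: sumr_ge0.
have /andP [h _] := box_sum_bounds R m f M N m0 f0 p1 p2; rewrite hT in h.
apply: le_trans h.
have [_ hM'] := divn_bounds M.*2.+1 m m0; have [_ hN'] := divn_bounds N.*2.+1 m m0.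
rewrite -/LM in hM'; rewrite -/LN in hN'.
rewrite (_ : _ * _ * (T * _) = T * (((M.*2.+1 %/ m)%:R * m%:R) * ((N.*2.+1 %/ m)%:R * m%:R))).
  rewrite ler_wpM2l //; apply: (@le_trans _ _ ((LM - m%:R) * (LN - m%:R))).
    rewrite -subr_ge0 (_ : _ - _ = m%:R ^+ 2); first by rewrite exprn_ge0.
    by ring.
  by rewrite ler_pM ?subr_ge0 // lerBlDr.
by ring.
Qed.

Lemma p2_leY p : p%:R <= Y -> (p ^ 2)%:R <= Y ^+ 2.
Proof. by move=> pY; rewrite natrX lerXn2r ?nnegrE. Qed.

Lemma p2_leY4 p : prime p -> p%:R <= Y -> (p ^ 2)%:R <= Y ^+ 4.
Proof.
move=> pp pY; apply: le_trans (p2_leY p pY) _.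
by rewrite ler_weXn2l // (le_trans _ pY) // ler1n prime_gt0.
Qed.

Section OnePrime.
Variable p : nat.
Hypotheses (pp : prime p) (pY : p%:R <= Y).

Lemma hit_mass : \sum_(0 <= i < p ^ 2) \sum_(0 <= j < p ^ 2) (x p) i%:Z j%:Z
   = density p * (p ^ 2)%:R ^+ 2 :> R.
Proof. by rewrite sum_hit // -natrX -expnM natrX densityK. Qed.

Lemma p2_gt0 : (0 < p ^ 2)%N.
Proof. by rewrite expn_gt0 prime_gt0. Qed.

Lemma hit_upper : box_sum (x p) <= 4 * density p * (LM * LN).
Proof.
have h : box_sum (x p) <= density p * ((LM + (p ^ 2)%:R) * (LN + (p ^ 2)%:R)).
  apply: (@box_sum_upper (p ^ 2)); rewrite ?hit_mass ?p2_gt0 // => a b.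
  - by rewrite (hit_periodic _ _ _ _ pp (dvdnn _)).
  - by rewrite (hit_periodic _ _ _ _ pp (dvdnn _)).
apply: le_trans h _; rewrite (_ : 4 * _ * _ = density p * ((LM + LM) * (LN + LN))); last by ring.
have h4 := p2_leY4 p pp pY.
by rewrite ler_wpM2l ?density_ge0 // ler_pM ?addr_ge0 // lerD2l; apply: le_trans h4 _.
Qed.

Lemma hit_lower : density p * (LM * LN - (p ^ 2)%:R * (LM + LN)) <= box_sum (x p).
Proof.
have h4 := p2_leY4 p pp pY.
apply: (@box_sum_lower (p ^ 2)); rewrite ?hit_mass ?p2_gt0 ?(le_trans h4) // => a b.
- by rewrite (hit_periodic _ _ _ _ pp (dvdnn _)).
- by rewrite (hit_periodic _ _ _ _ pp (dvdnn _)).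
Qed.

(** A 0/1 variable equals its square, so the expansion is linear in the hit: 4 comes from
    [hit_upper] and 1 from density^2 <= density. *)
Lemma variance_diag :
  box_sum (fun a b => ((x p) a b - density p) * ((x p) a b - density p))
    <= 5 * density p * (LM * LN).
Proof.
have -> : box_sum (fun a b => ((x p) a b - density p) * ((x p) a b - density p)) =
   box_sum (x p) + (- 2 * density p) * box_sum (x p) + density p ^+ 2 * (LM * LN).
  rewrite -box_sumZ -box_sum_cst -!box_sumD; apply: eq_bigr => a _; apply: eq_bigr => b _.
  by case: (hit p a b) => /=; ring.
have h0 : 0 <= box_sum (x p) by apply: sumr_ge0 => a _; apply: sumr_ge0.
have d0 := density_ge0 p; have d1 := density_le1 p pp; have hu := hit_upper.
have n0 : 0 <= LM * LN by rewrite mulr_ge0.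
have : density p ^+ 2 * (LM * LN) <= density p * (LM * LN).
  by rewrite ler_wpM2r // expr2 ler_piMl.
have : 0 <= density p * box_sum (x p) by rewrite mulr_ge0.
by move: hu; set d := density p; set n := LM * LN; set S := box_sum _; lra.
Qed.

End OnePrime.

Lemma variance_offdiag p q : prime p -> prime q -> p != q -> p%:R <= Y -> q%:R <= Y ->
  Y ^+ 4 * box_sum (fun a b => ((x p) a b - density p) * ((x q) a b - density q))
    <= 7 * density p * density q * (p%:R ^+ 2 * q%:R ^+ 2) * (LM * LN).
Proof.
move=> pp qp npq pY qY.
have -> : box_sum (fun a b => ((x p) a b - density p) * ((x q) a b - density q)) =
   box_sum (fun a b => (x p) a b * (x q) a b) + (- density p) * box_sum (x q)
    + (- density q) * box_sum (x p) + (density p * density q) * (LM * LN).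
  rewrite -!box_sumZ -box_sum_cst -!box_sumD; apply: eq_bigr => a _; apply: eq_bigr => b _.
  by ring.
set m := (p ^ 2 * q ^ 2)%N.
have cop : coprime (p ^ 2) (q ^ 2).
  by rewrite coprimeXl // coprimeXr // prime_coprime // dvdn_prime2.
have hpm : (p ^ 2 %| m)%N by rewrite dvdn_mulr.
have hqm : (q ^ 2 %| m)%N by rewrite dvdn_mull.
have per r k a b : prime r -> (r ^ 2 %| k)%N ->
    ((x r) (a + k%:Z) b = (x r) a b :> R) * ((x r) a (b + k%:Z) = (x r) a b :> R).
  by move=> rp rk; rewrite !(hit_periodic r k a b rp rk).
have hpq : box_sum (fun a b => (x p) a b * (x q) a b)
    <= density p * density q * ((LM + m%:R) * (LN + m%:R)).
  apply: (@box_sum_upper m).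
  - by rewrite muln_gt0 !p2_gt0.
  - by move=> a b; rewrite mulr_ge0.
  - by move=> a b; rewrite !per.
  - by move=> a b; rewrite !per.
  - rewrite (@chinese_sum2 R (p ^ 2) (q ^ 2) (fun i j => (x p) i%:Z j%:Z)
      (fun i j => (x q) i%:Z j%:Z)) ?p2_gt0 //.
    + by rewrite !hit_mass // /m natrM; ring.
    + by move=> i j; rewrite PoszD per.
    + by move=> i j; rewrite PoszD per.
    + by move=> i j; rewrite PoszD per.
    + by move=> i j; rewrite PoszD per.
have hp := hit_lower p pp pY; have hq := hit_lower q qp qY.
have dp := density_ge0 p; have dq := density_ge0 q.
have em : m%:R = p%:R ^+ 2 * q%:R ^+ 2 :> R by rewrite /m natrM !natrX.
have p1 : 1 <= p%:R ^+ 2 :> R by rewrite -natrX ler1n p2_gt0.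
have q1 : 1 <= q%:R ^+ 2 :> R by rewrite -natrX ler1n p2_gt0.
have mY : m%:R <= Y ^+ 4.
  rewrite em (_ : Y ^+ 4 = Y ^+ 2 * Y ^+ 2); last by ring.
  by rewrite ler_pM ?exprn_ge0 // -natrX p2_leY.
rewrite -em; rewrite !natrX in hp hq.
apply: (offdiag_arith em p1 q1) => //.
by rewrite exprn_ge0.
Qed.

End Variance.

Section SecondMoment.
Variables (R : realType) (Y : R).
Hypothesis Y_gt0 : 0 < Y.

Local Notation small p := (prime p && ((p : nat)%:R <= Y)).
Local Notation K := (Num.truncn Y).+1.

Lemma Pi_lt_countE a b :
  (Pi_lt_count a b Y)%:R = \sum_(p < K | small p) (hit p a b)%:R :> R.
Proof.
rewrite /Pi_lt_count -sum1_card natr_sum big_mkcond [RHS]big_mkcond /=.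
apply: eq_bigr => p _; rewrite inE -/(hit p a b).
by case: (prime p) => //=; case: (_ <= Y) => //=; case: (hit p a b).
Qed.

Lemma PYE : PY Y = \sum_(p < K | small p) density R p.
Proof. by []. Qed.

(** The one use of [card_frakA]. The trivial bound p^4 would give order Y^5 by the same count, and a
    second moment bound weaker by a factor Y. *)
Lemma frakA_mass : \sum_(p < K | small p) density R p * p%:R ^+ 4 <= 11 * Y ^+ 4.
Proof.
(* The index 0 is not prime; without it [truncn Y] terms remain, which is at most Y. *)
rewrite big_mkcond big_ord_recl /= add0r.
apply: (@le_trans _ _ (\sum_(i < Num.truncn Y) 11 * Y ^+ 3)).
  apply: ler_sum => i _; case: ifP => [/andP [pp pY]|_]; last first.
    by rewrite mulr_ge0 // exprn_ge0 // ltW.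
  have h : #|frakA (bump 0 i)|%:R <= 11 * (bump 0 i)%:R ^+ 3 :> R.
    by rewrite -natrX -natrM ler_nat card_frakA.
  by rewrite densityK //; apply: le_trans h _; rewrite ler_wpM2l // lerXn2r ?nnegrE // ltW.
rewrite sumr_const card_ord -mulr_natl.
have : (Num.truncn Y)%:R <= Y by rewrite truncn_le ltW.
have : 0 <= Y ^+ 3 by rewrite exprn_ge0 // ltW.
rewrite (_ : Y ^+ 4 = Y * Y ^+ 3); last by ring.
by move: (Y ^+ 3) => y3 h0 h1; have := ler_wpM2r h0 h1; lra.
Qed.

Variables M N : nat.
Local Notation LM := (M.*2.+1%:R : R).
Local Notation LN := (N.*2.+1%:R : R).
Hypothesis hM : Y ^+ 4 <= LM.
Hypothesis hN : Y ^+ 4 <= LN.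

Lemma box_sum_sum (I : finType) (P : pred I) (f : I -> int -> int -> R) :
  box_sum R M N (fun a b => \sum_(i | P i) f i a b) = \sum_(i | P i) box_sum R M N (f i).
Proof.
rewrite /box_sum [RHS]exchange_big; apply: eq_bigr => a _.
by rewrite exchange_big.
Qed.

Lemma second_moment :
  box_sum R M N (fun a b => ((Pi_lt_count a b Y)%:R - PY Y) ^+ 2) <= 82 * PY Y * (LM * LN).
Proof.
pose z (p : 'I_K) a b : R := (hit p a b)%:R - density R p.
have -> : box_sum R M N (fun a b => ((Pi_lt_count a b Y)%:R - PY Y) ^+ 2) =
    \sum_(p < K | small p) \sum_(q < K | small q) box_sum R M N (fun a b => z p a b * z q a b).
  under [RHS]eq_bigr => p _ do rewrite -box_sum_sum.
  rewrite -box_sum_sum; apply: eq_bigr => a _; apply: eq_bigr => b _.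
  rewrite Pi_lt_countE PYE -sumrB expr2 mulr_suml; apply: eq_bigr => p _.
  by rewrite mulr_sumr.
have Y4 : 0 < Y ^+ 4 by rewrite exprn_gt0.
set n := LM * LN; have n0 : 0 <= n by rewrite mulr_ge0.
rewrite -(ler_pM2l Y4) mulr_sumr.
have c0 : 0 <= 7 / 2 * n by rewrite mulr_ge0 // divr_ge0.
pose d p := density R p; have d0 p : 0 <= d p by apply: density_ge0.
pose w p := d p * p%:R ^+ 4; have w0 p : 0 <= w p by rewrite mulr_ge0 ?d0 // exprn_ge0.
(* Off the diagonal, 2 p^2 q^2 <= p^4 + q^4 turns the double sum into PY times the sum of
   [frakA_mass]. The nonnegative terms with q = p are added to make that double sum complete. *)
apply: (@le_trans _ _ (\sum_(p < K | small p) (5 * Y ^+ 4 * n * d p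
    + 7 / 2 * n * \sum_(q < K | small q) (w p * d q + d p * w q)))).
  apply: ler_sum => p /andP [pp pY]; rewrite mulr_sumr.
  have pS : small p by rewrite pp pY.
  rewrite [X in _ <= _ + X]mulr_sumr [X in X <= _](bigD1 p pS) [X in _ <= _ + X](bigD1 p pS) /= addrA.
  apply: lerD.
    rewrite -[X in X <= _]addr0; apply: lerD; last by rewrite mulr_ge0 // addr_ge0 // mulr_ge0.
    have := variance_diag R Y M N (ltW Y_gt0) hM hN p pp pY.
    move/(ler_wpM2l (ltW Y4)); rewrite -/n -/(d p).
    by move/le_trans; apply; rewrite (_ : _ * (_ * n) = 5 * Y ^+ 4 * n * d p) //; ring.
  apply: ler_sum => q /andP [/andP [qp qY] npq].
  have npq' : (p : nat) != q by rewrite eq_sym.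
  have := variance_offdiag R Y M N (ltW Y_gt0) hM hN p q pp qp npq' pY qY.
  move/le_trans; apply; rewrite -/n -/(d p) -/(d q) /w.
  have : 0 <= d p * d q * (p%:R ^+ 2 - q%:R ^+ 2) ^+ 2 * n.
    by rewrite mulr_ge0 // mulr_ge0 ?sqr_ge0 // mulr_ge0.
  have -> : 7 / 2 * n * (d p * p%:R ^+ 4 * d q + d p * (d q * q%:R ^+ 4)) =
    7 * d p * d q * (p%:R ^+ 2 * q%:R ^+ 2) * n
     + 7 / 2 * (d p * d q * (p%:R ^+ 2 - q%:R ^+ 2) ^+ 2 * n) by field.
  by move=> h; rewrite lerDl mulr_ge0 // divr_ge0.
rewrite big_split /= -!mulr_sumr -PYE.
have -> : \sum_(p < K | small p) \sum_(q < K | small q) (w p * d q + d p * w q) =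
    2 * (PY Y * \sum_(p < K | small p) w p).
  under eq_bigr => p _ do rewrite big_split -!mulr_sumr -PYE.
  by rewrite big_split /= -!mulr_suml -PYE; ring.
have hw := frakA_mass; rewrite -/(w _) in hw.
have P0 : 0 <= PY Y by rewrite PYE; apply: sumr_ge0 => p _; apply: d0.
have nP : 0 <= n * PY Y by rewrite mulr_ge0.
(* Diagonal and off-diagonal parts add up to 5 + 7 * 11 = 82. *)
have := ler_wpM2l nP hw; set W := \sum_(p < K | _) _; move: (Y ^+ 4) => y4.
move: (PY Y) => P; lra.
Qed.

Definition bad_pair (beta : R) (ab : int * int) : bool :=
  Num.sqrt (PY Y) * beta <= `|(Pi_lt_count ab.1 ab.2 Y)%:R - PY Y|.

Definition int_box : seq (int * int) := [seq (a, b) | a <- int_range M, b <- int_range N].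

Lemma size_int_box : size int_box = (M.*2.+1 * N.*2.+1)%N.
Proof. by rewrite size_allpairs /int_range !size_map !size_iota. Qed.

Lemma count_bad (beta : R) : 0 < beta -> 0 < PY Y ->
  (count (bad_pair beta) int_box)%:R * beta ^+ 2 <= 82 * (size int_box)%:R.
Proof.
move=> b0 P0; rewrite -(ler_pM2l P0) size_int_box natrM.
have -> : PY Y * ((count (bad_pair beta) int_box)%:R * beta ^+ 2) =
  (count (bad_pair beta) int_box)%:R * (PY Y * beta ^+ 2) by ring.
have -> : PY Y * (82 * (LM * LN)) = 82 * PY Y * (LM * LN) by ring.
apply: le_trans second_moment.
rewrite /box_sum -sum1_count natr_sum mulr_suml big_mkcond /=.
rewrite -(@big_allpairs _ _ _ _ _ _ _ (fun ab => ((Pi_lt_count ab.1 ab.2 Y)%:R - PY Y) ^+ 2)).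
apply: ler_sum => -[a b] _; case: ifP => [h|_]; last by rewrite sqr_ge0.
have b1 : 0 <= Num.sqrt (PY Y) * beta by rewrite mulr_ge0 ?sqrtr_ge0 // ltW.
have : (Num.sqrt (PY Y) * beta) ^+ 2 <= `|(Pi_lt_count a b Y)%:R - PY Y| ^+ 2.
  by rewrite lerXn2r ?nnegrE.
by rewrite exprMn sqr_sqrtr ?(ltW P0) // real_normK ?num_real // mul1r.
Qed.

End SecondMoment.

(** * Boxes and minimal models *)

Lemma mem_int_range K (a : int) : (a \in int_range K) = (`|a| <= K)%N.
Proof.
apply/mapP/idP => [[i]|h].
  by rewrite mem_iota => hi ->; lia.
exists (absz (a + K%:Z)); first by rewrite mem_iota; lia.
by lia.
Qed.

Lemma uniq_int_range K : uniq (int_range K).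
Proof. by rewrite map_inj_uniq ?iota_uniq // => i j /addIr []. Qed.

Lemma uniq_pairs (s t : seq int) : uniq s -> uniq t -> uniq [seq (a, b) | a <- s, b <- t].
Proof. by move=> us ut; apply: allpairs_uniq => // -[a b] [c d]. Qed.

Lemma mem_int_box M N (ab : int * int) :
  (ab \in int_box M N) = (`|ab.1| <= M)%N && (`|ab.2| <= N)%N.
Proof.
apply/allpairsP/idP => [[[a b] [/= ha hb ->]]|/andP [ha hb]].
  by rewrite /= -!mem_int_range ha hb.
by exists ab; rewrite !mem_int_range; case: ab ha hb.
Qed.

Section Boxes.
Variable R : realType.

Lemma absz_intr (a : int) : `|a|%:~R = `|a|%N%:R :> R.
Proof. by rewrite -abszE pmulrn. Qed.

(** The inequality k < C is strict, so M is C - 1 when C is an integer and [truncn C] otherwise. *)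
Lemma nat_lt_bound (C : R) : 0 < C -> exists M : nat,
  [/\ forall k : nat, (k%:R < C) = (k <= M)%N, C <= M.+1%:R & (M <= Num.truncn C)%N].
Proof.
move=> C0; have [lo hi] := andP (truncn_itv (ltW C0)).
have [e|ne] := eqVneq (Num.truncn C)%:R C.
  have t0 : (0 < Num.truncn C)%N by rewrite -(ltr0n R) e.
  exists (Num.truncn C).-1; rewrite prednK // leq_pred e; split => // k.
  by rewrite -{1}e ltr_nat -[in LHS](prednK t0) ltnS.
exists (Num.truncn C); split=> // [k|]; last exact: ltW.
apply/idP/idP => [h|h].
  by rewrite -ltnS -(ltr_nat R); apply: lt_trans hi.
by apply: le_lt_trans (_ : (Num.truncn C)%:R < C); rewrite ?ler_nat // lt_neqAle ne.
Qed.

Lemma box_perm (C D : R) : 0 < C -> 0 < D -> exists M N,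
  [/\ C <= M.+1%:R, D <= N.+1%:R & perm_eq (box C D) (int_box M N)].
Proof.
move=> C0 D0; have [M [hM CM MC]] := nat_lt_bound C C0; have [N [hN DN ND]] := nat_lt_bound D D0.
exists M, N; split=> //; apply: uniq_perm.
- by rewrite filter_uniq // uniq_pairs ?uniq_int_range.
- by rewrite uniq_pairs ?uniq_int_range.
case=> a b; rewrite mem_int_box mem_filter !absz_intr hM hN.
apply/andb_idr => /andP [ha hb]; apply/allpairsP; exists (a, b).
rewrite /= in ha hb.
by rewrite !mem_int_range; split=> //=; lia.
Qed.

Lemma box_bad_bound (Y beta : R) M N : 0 < Y -> 0 < PY Y -> 0 < beta ->
    Y ^+ 4 <= M.+1%:R -> Y ^+ 4 <= N.+1%:R ->
  (count (bad_pair R Y beta) (int_box M N))%:R <= 82 / beta ^+ 2 * (size (int_box M N))%:R :> R.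
Proof.
move=> Y0 P0 b0 hM hN; have b2 : 0 < beta ^+ 2 by rewrite exprn_gt0.
rewrite mulrAC ler_pdivlMr //; apply: count_bad => //.
  by apply: le_trans hM _; rewrite ler_nat; lia.
by apply: le_trans hN _; rewrite ler_nat; lia.
Qed.

(** Replaces real cube and square roots: M is the largest natural number with M^e <= X. *)
Lemma power_bound e (X : R) : (0 < e)%N -> 1 <= X -> exists M : nat,
  forall k : nat, (k%:R ^+ e <= X) = (k <= M)%N.
Proof.
move=> e0 X1; pose P k := (k%:R ^+ e : R) <= X.
have P1 : exists k, P k by exists 1%N; rewrite /P expr1n.
have X0 : 0 <= X by apply: le_trans X1.
have bnd k : P k -> (k <= Num.truncn X)%N.
  move=> hk; rewrite truncn_ge_nat //; apply: le_trans (hk : k%:R ^+ e <= X).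
  rewrite -natrX ler_nat; case: k {hk} => // k; rewrite -{1}[k.+1]expn1 leq_pexp2l //.
have [M hM hmax] := ex_maxnP P1 bnd.
exists M => k; apply/idP/idP => [|hk]; first exact: hmax.
by apply: le_trans hM; rewrite lerXn2r ?nnegrE // ler_nat.
Qed.

(** Telescoping: the constant 4 is affordable because 4 / (t+1)^4 <= 1/t - 1/(t+1), that is, 4 t <=
    (t+1)^3. Hence at most a quarter of the integers up to M are divisible by some l^4 with l >=
    2. *)
Lemma quartic_multiples k M :
  4 * \sum_(l <- iota 2 k) (M %/ l ^ 4)%:R <= M%:R * (1 - k.+1%:R^-1) :> R.
Proof.
elim: k => [|k ih]; first by rewrite big_nil mulr0 invr1 subrr mulr0.
rewrite -[k.+1]addn1 iotaD big_cat /= big_seq1 mulrDr addn1.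
apply: le_trans (lerD ih (lexx _)) _; rewrite -lerBrDl.
have -> : (2 + k)%N = k.+2 by [].
have hq : (M %/ k.+2 ^ 4)%:R <= M%:R / k.+2%:R ^+ 4 :> R.
  by rewrite ler_pdivlMr ?exprn_gt0 // -natrX -natrM ler_nat leq_divM.
have k1 : 0 < k.+1%:R :> R by []. have k2 : k.+2%:R = k.+1%:R + 1 :> R by rewrite natr1.
apply: le_trans (ler_wpM2l (_ : 0 <= 4) hq) _ => //.
rewrite k2; move: (k.+1%:R) k1 => t t0; have M0 : 0 <= M%:R :> R by [].
have -> : M%:R * (1 - (t + 1)^-1) - M%:R * (1 - t^-1) = M%:R * (t * (t + 1))^-1.
  by field; rewrite !lt0r_neq0 // addr_gt0.
rewrite mulrCA ler_wpM2l // ler_pdivrMr ?exprn_gt0 ?addr_gt0 //.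
rewrite ler_pdivlMl ?mulr_gt0 ?addr_gt0 //.
nra.
Qed.

Definition quartic_free M := [seq i <- iota 1 M | ~~ has (fun l => l ^ 4 %| i)%N (iota 2 M)].

Lemma size_quartic_free M : (3 * M <= 4 * size (quartic_free M))%N.
Proof.
pose P i := has (fun l => l ^ 4 %| i)%N (iota 2 M).
have -> : size (quartic_free M) = count (predC P) (iota 1 M) by rewrite size_filter.
have h := count_predC P (iota 1 M); rewrite size_iota in h.
suff : (4 * count P (iota 1 M) <= M)%N.
  by move: h; clear; lia.
rewrite -(ler_nat R) natrM; apply: (@le_trans _ _ (M%:R * (1 - M.+1%:R^-1))); last first.
  by rewrite ler_piMr // lerBlDr lerDl invr_ge0.
apply: le_trans (quartic_multiples M M); rewrite ler_wpM2l //.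
rewrite -natr_sum ler_nat -sum1_count big_mkcond /=.
under [X in (_ <= X)%N]eq_bigr do rewrite divn_count_dvd.
rewrite exchange_big /= /index_iota subn1 /=; apply: leq_sum => i _.
case: ifP => // /hasP [l hl hli].
by rewrite (big_rem l) //= hli.
Qed.

(** A cheap supply of minimal models: if a > 0 has no fourth-power divisor, then every (a, b) is
    minimal and 4 a^3 + 27 b^2 > 0. At least three quarters of the a in 1..M qualify. *)
Lemma curves_lower (M N : nat) (X : R) : (0 < M)%N ->
    (forall k : nat, (k%:R ^+ 3 <= X) = (k <= M)%N) ->
    (forall k : nat, (k%:R ^+ 2 <= X) = (k <= N)%N) ->
  {subset curves_upto X <= int_box M N} /\ (size (int_box M N) <= 4 * size (curves_upto X))%N.
Proof.
move=> M0 hM hN.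
have hh a b : ((height a b)%:~R <= X) = (`|a| <= M)%N && (`|b| <= N)%N.
  rewrite -hM -hN /height -[X in Num.max _ X]real_normK ?num_real //.
  rewrite -!absz_intr -!rmorphXn /=.
  by rewrite /Order.max; case: ltP => h; apply/idP/andP => [h'|[]] //; split => //;
    apply: le_trans h'; rewrite ler_int // ltW.
split.
  by move=> [a b]; rewrite mem_filter hh => /andP [/andP [_ h] _]; rewrite mem_int_box.
have le_tr k : (k%:R : R) <= X -> (k <= (Num.truncn X).+1)%N.
  by move=> hk; rewrite ltnW // -(ltr_nat R); apply: le_lt_trans hk _; apply: truncnS_gt.
have hMX : (M <= (Num.truncn X).+1)%N.
  apply: le_tr; apply: le_trans (_ : M%:R ^+ 3 <= X); last by rewrite hM.
  by rewrite -natrX ler_nat -{1}[M]expn1 leq_pexp2l.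
have hNX : (N <= (Num.truncn X).+1)%N.
  apply: le_tr; apply: le_trans (_ : N%:R ^+ 2 <= X); last by rewrite hN.
  by rewrite -natrX ler_nat; case: (N) => // n; rewrite -{1}[n.+1]expn1 leq_pexp2l.
have sub : {subset [seq (a, b) | a <- [seq i%:Z | i <- quartic_free M], b <- int_range N]
    <= curves_upto X}.
  move=> ab /allpairsP [[a b] [/= /mapP [i hi ->] hb ->]].
  move: hi; rewrite mem_filter mem_iota add1n => /andP [hfree /andP [i1 iM]].
  rewrite mem_int_range in hb.
  rewrite mem_filter hh; apply/andP; split; last first.
    by apply/allpairsP; exists (i%:Z, b); rewrite !mem_int_range; split=> //=; lia.
  rewrite /= hb -ltnS iM !andbT; apply/andP; split.
    have i3 : 0 < i%:Z ^+ 3 by rewrite exprn_gt0.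
    have b2 : 0 <= b ^+ 2 by rewrite sqr_ge0.
    by apply: lt0r_neq0; move: (i%:Z ^+ 3) (b ^+ 2) i3 b2 => u v; clear; lia.
  apply/asboolP => l pl [h4 _].
  have h4' : (l ^ 4 %| i)%N by move: h4; rewrite dvdzE abszX !absz_nat.
  case/negP: hfree; apply/hasP; exists l => //.
  have := dvdn_leq i1 h4'; have l2 := prime_gt1 pl.
  have : (l <= l ^ 4)%N by rewrite -{1}[l]expn1 leq_pexp2l // ltnW.
  by rewrite mem_iota; lia.
have := uniq_leq_size _ sub; rewrite size_allpairs size_map size_int_box.
have -> : size (int_range N) = N.*2.+1 by rewrite size_map size_iota.
have u : uniq [seq (a, b) | a <- [seq i%:Z | i <- quartic_free M], b <- int_range N].
  by rewrite uniq_pairs ?uniq_int_range // map_inj_uniq ?filter_uniq ?iota_uniq // => i j [].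
move=> /(_ u); have := size_quartic_free M.
move: (size (quartic_free M)) (size (curves_upto X)) => q s.
(* M > 0 gives 3 M >= 2 M + 1, so these pairs fill at least a quarter of the box. *)
by move: M0; clear; nia.
Qed.

End Boxes.

(** * Conclusion for boxes and for curves ordered by height *)

Theorem theorem5p4 (R : realType) :
  exists c : R, 0 < c /\
  forall Y : R, 0 < Y -> 0 < PY Y ->
  forall beta : R, 0 < beta ->
    (* (i) lower density (liminf over heights X) of good curves >= 1 - c/beta^2 *)
    (forall eps : R, 0 < eps -> exists X0 : R, forall X : R, X0 <= X ->
        1 - c / beta ^+ 2 - eps <=
        (size (curves_good_upto Y beta X))%:R / (size (curves_upto X))%:R) /\
    (* (ii) *)
    (forall C D : R, Y ^+ 4 < C -> Y ^+ 4 < D ->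
        (size (box_bad Y beta C D))%:R / (size (box C D))%:R < c / beta ^+ 2).
Proof.
(* 328 = 4 * 82: 82 bounds the bad pairs of a box, and 4 pays in (i) for passing from the box to
   minimal models; in (ii) the slack makes the inequality strict. *)
exists 328; split=> // Y Y0 P0 beta b0.
have Y4 : 0 < Y ^+ 4 by rewrite exprn_gt0.
have b2 : 0 < beta ^+ 2 by rewrite exprn_gt0.
split=> [eps eps0|C D hC hD]; last first.
  have [M [N [CM DN hp]]] := box_perm R C D (lt_trans Y4 hC) (lt_trans Y4 hD).
  have h := box_bad_bound R Y beta M N Y0 P0 b0 (le_trans (ltW hC) CM) (le_trans (ltW hD) DN).
  have -> : size (box_bad Y beta C D) = count (bad_pair R Y beta) (int_box M N).
    by rewrite size_filter; move/permP: hp; apply.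
  rewrite (perm_size hp); have s0 : 0 < (size (int_box M N))%:R :> R.
    by rewrite size_int_box ltr0n muln_gt0.
  rewrite ltr_pdivrMr //; apply: le_lt_trans h _; rewrite ltr_pM2r // ltr_pM2r ?invr_gt0 //.
  by rewrite ltr_nat.
pose k := (Num.truncn (Y ^+ 4)).+1.
have hk : Y ^+ 4 <= k%:R by rewrite ltW // truncnS_gt.
(* X >= k^3 makes the cube root and the square root of X, the sides of the height box, at least k >=
   Y^4. *)
exists (k%:R ^+ 3) => X hX.
have k1 : 1 <= k%:R :> R by rewrite ler1n.
have X1 : 1 <= X by apply: le_trans hX; rewrite exprn_ege1.
have [M hM] := power_bound R 3 X isT X1; have [N hN] := power_bound R 2 X isT X1.
have kM : (k <= M)%N by rewrite -hM.
have kN : (k <= N)%N by rewrite -hN; apply: le_trans hX; rewrite ler_weXn2l.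
have M0 : (0 < M)%N by apply: leq_trans kM.
have [sub low] := curves_lower R M N X M0 hM hN.
have hYM : Y ^+ 4 <= M.+1%:R by apply: le_trans hk _; rewrite ler_nat leqW.
have hYN : Y ^+ 4 <= N.+1%:R by apply: le_trans hk _; rewrite ler_nat leqW.
have h := box_bad_bound R Y beta M N Y0 P0 b0 hYM hYN.
have le_bad : (count (bad_pair R Y beta) (curves_upto X) <= count (bad_pair R Y beta) (int_box M N))%N.
  rewrite -!size_filter; apply: uniq_leq_size.
    by rewrite !filter_uniq // uniq_pairs ?uniq_int_range.
  by move=> ab; rewrite !mem_filter => /andP [-> hab] /=; apply: sub; rewrite mem_filter.
have eg : size (curves_good_upto Y beta X) = count (predC (bad_pair R Y beta)) (curves_upto X).
  by rewrite size_filter; apply: eq_count => ab /=; rewrite /bad_pair -ltNge mulrC.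
have hc := count_predC (bad_pair R Y beta) (curves_upto X).
have s0 : 0 < (size (curves_upto X))%:R :> R.
  rewrite ltr0n -(ltn_pmul2l (isT : 0 < 4)%N) muln0; apply: leq_trans low.
  by rewrite size_int_box muln_gt0.
rewrite lerBlDr; apply: ler_wpDr; first exact: ltW.
rewrite ler_pdivlMr // eg -[in X in X <= _]hc.
have hcR : (size (curves_upto X))%:R = (count (bad_pair R Y beta) (curves_upto X))%:R
    + (count (predC (bad_pair R Y beta)) (curves_upto X))%:R :> R by rewrite -natrD hc.
rewrite hc mulrBl mul1r lerBlDr {1}hcR addrC lerD2l.
apply: (@le_trans _ _ (count (bad_pair R Y beta) (int_box M N))%:R); first by rewrite ler_nat.
apply: le_trans h _.
have -> : 328 / beta ^+ 2 * (size (curves_upto X))%:R =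
  82 / beta ^+ 2 * (4 * (size (curves_upto X))%:R) by ring.
by rewrite ler_wpM2l ?divr_ge0 ?sqr_ge0 // -natrM ler_nat.
Qed.
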